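(* Assume that $L$ is countable and $T$ is NIP. Let $M$ be a countable model and $\phi(x;b)\in L(\mathcal U)$ non-dividing over $M$. Assume that $q=\mathrm{tp}(b/M)$ has only countably many global coheirs. Then there is $a\in \mathcal U$ such that $\phi(a;y)$ is in every global coheir of $q$.
   Context: $T$ is a complete theory in a language $L$ and $\mathcal U$ is a monster model. A global coheir of $q\in S(M)$ is a global type extending $q$ which is finitely satisfiable in $M$. A partial type $\pi(x)$ over $B\supseteq M$ divides over $M$ if there is an $M$-indiscernible sequence $(b_i:i<\omega)$ and a formula $\phi(x;y)$ such that $\pi(x)\vdash\phi(x;b_0)$ and $\{\phi(x;b_i):i<\omega\}$ is inconsistent. *)

(* Defs.v *)
From mathcomp Require Import all_boot.
From mathcomp Require Import boolp classical_sets functions cardinality.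

Set Implicit Arguments.
Unset Strict Implicit.
Unset Printing Implicit Defensive.

Local Open Scope classical_set_scope.
Local Open Scope card_scope.

Record language : Type := Language {
  funs : Type;
  rels : Type;
  fun_arity : funs -> nat;
  rel_arity : rels -> nat }.

Definition countable_language (L : language) : Prop :=
  countable [set: funs L] /\ countable [set: rels L].

(* Formulas are indexed by the type [V] of their free variables; the variable
   bound by [All] is the [None] of [option V]. A partitioned formula phi(x;y)
   with |x| = n and |y| = m is an element of [form L ('I_n + 'I_m)]. *)
Inductive term (L : language) (V : Type) : Type :=
| Var of V
| App (f : funs L) of ('I_(fun_arity f) -> term L V).

Inductive form (L : language) (V : Type) : Type :=
| Bot
| Eq of term L V & term L V
| Rel (r : rels L) of ('I_(rel_arity r) -> term L V)
| Imp of form L V & form L V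
| All of form L (option V).

Arguments Bot {L V}.

Definition Neg (L : language) (V : Type) (phi : form L V) : form L V :=
  Imp phi Bot.

Fixpoint tmap (L : language) (V W : Type) (g : V -> W) (t : term L V)
    : term L W :=
  match t with
  | Var v => Var L (g v)
  | App f ts => App (fun i => tmap g (ts i))
  end.

(* Capture-free renaming of the free variables along [g]. *)
Fixpoint fmap (L : language) (V W : Type) (g : V -> W) (phi : form L V)
    {struct phi} : form L W :=
  match phi with
  | Bot => Bot
  | Eq s t => Eq (tmap g s) (tmap g t)
  | Rel r ts => Rel (fun i => tmap g (ts i))
  | Imp p q => Imp (fmap g p) (fmap g q)
  | All p => All (fmap (omap g) p)
  end.

Record structure (L : language) : Type := Structure {
  carrier :> Type;
  carrier_inhabited : inhabited carrier;
  fun_interp : forall f : funs L, ('I_(fun_arity f) -> carrier) -> carrier;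
  rel_interp : forall r : rels L, ('I_(rel_arity r) -> carrier) -> Prop }.

Fixpoint eval (L : language) (N : structure L) (V : Type) (e : V -> N)
    (t : term L V) : N :=
  match t with
  | Var v => e v
  | App f ts => fun_interp (fun i => eval e (ts i))
  end.

Fixpoint sat (L : language) (N : structure L) (V : Type) (phi : form L V)
    (e : V -> N) {struct phi} : Prop :=
  match phi with
  | Bot => False
  | Eq s t => eval e s = eval e t
  | Rel r ts => rel_interp (fun i => eval e (ts i))
  | Imp p q => sat p e -> sat q e
  | All p => forall x : N, sat p (fun v => if v is Some w then e w else x)
  end.

Definition sentence (L : language) : Type := form L void.

Definition theory (L : language) : Type := set (sentence L).

Definition holds (L : language) (N : structure L) (s : sentence L) : Prop :=
  sat s (fun v : void => match v return N with end).

Definition models (L : language) (N : structure L) (T : theory L) : Prop :=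
  forall s, T s -> holds N s.

Definition theory_entails (L : language) (T : theory L) (s : sentence L)
    : Prop :=
  forall N : structure L, models N T -> holds N s.

Definition complete_theory (L : language) (T : theory L) : Prop :=
  (exists N : structure L, models N T) /\
  forall s, theory_entails T s \/ theory_entails T (Neg s).

Definition pair_env (U X Y : Type) (a : X -> U) (b : Y -> U) (v : X + Y) : U :=
  match v with inl i => a i | inr j => b j end.

Definition has_IP (L : language) (T : theory L) (n m : nat)
    (phi : form L ('I_n + 'I_m)) : Prop :=
  exists (N : structure L) (a : nat -> 'I_n -> N) (b : set nat -> 'I_m -> N),
    models N T /\ forall i I, sat phi (pair_env (a i) (b I)) <-> I i.

Definition NIP (L : language) (T : theory L) : Prop :=
  forall n m (phi : form L ('I_n + 'I_m)), ~ has_IP T phi.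

Definition fun_closed (L : language) (U : structure L) (A : set U) : Prop :=
  forall (f : funs L) (x : 'I_(fun_arity f) -> U),
    (forall i, A (x i)) -> A (fun_interp x).

Definition induced (L : language) (U : structure L) (A : set U)
    (A0 : inhabited A) (clA : fun_closed A) : structure L :=
  {| carrier := A;
     carrier_inhabited := A0;
     fun_interp := fun f (x : 'I_(fun_arity f) -> A) =>
       exist _ (fun_interp (fun i => val (x i)))
         (mem_set (clA f (fun i => val (x i)) (fun i => set_valP (x i))));
     rel_interp := fun r (x : 'I_(rel_arity r) -> A) =>
       rel_interp (fun i => val (x i)) |}.

Definition elementary_substructure (L : language) (U : structure L)
    (A : set U) : Prop :=
  exists (A0 : inhabited A) (clA : fun_closed A),
    forall n (phi : form L 'I_n) (e : 'I_n -> induced A0 clA),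
      sat phi e <-> sat phi (fun i => val (e i) : U).

(* Formulas of L(U) in the variables [V]: parameters are the free variables
   of the form [inr c], always interpreted by [c] itself. *)
Definition pform (L : language) (U : structure L) (V : Type) : Type :=
  form L (V + U).

Definition psat (L : language) (U : structure L) (V : Type)
    (psi : pform U V) (a : V -> U) : Prop :=
  sat psi (pair_env a id).

Definition over (L : language) (U : structure L) (V : Type) (A : set U)
    (psi : pform U V) : Prop :=
  exists psi0 : form L (V + A),
    psi = fmap (fun v => match v with
                         | inl i => inl i
                         | inr c => inr (val c)
                         end) psi0.

(* phi(x;b) *)
Definition inst_right (L : language) (U : structure L) (X Y : Type)
    (phi : form L (X + Y)) (b : Y -> U) : pform U X :=
  fmap (fun v => match v with inl i => inl i | inr j => inr (b j) end) phi.

(* phi(a;y) *)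
Definition inst_left (L : language) (U : structure L) (X Y : Type)
    (phi : form L (X + Y)) (a : X -> U) : pform U Y :=
  fmap (fun v => match v with inl i => inr (a i) | inr j => inl j end) phi.

Definition fin_sat_in (L : language) (U : structure L) (V : Type)
    (A : set U) (p : set (pform U V)) : Prop :=
  forall s : set (pform U V), finite_set s -> s `<=` p ->
    exists a : V -> U,
      (forall v, A (a v)) /\ forall psi, s psi -> psat psi a.

(* Consistency with the elementary diagram of U: since that theory is
   complete, this amounts to finite satisfiability in U. *)
Definition consistent (L : language) (U : structure L) (V : Type)
    (p : set (pform U V)) : Prop :=
  fin_sat_in setT p.

Definition entails (L : language) (U : structure L) (V : Type)
    (p : set (pform U V)) (psi : pform U V) : Prop :=
  exists s : set (pform U V), [/\ finite_set s, s `<=` p &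
    forall a : V -> U, (forall chi, s chi -> psat chi a) -> psat psi a].

Definition complete_type (L : language) (U : structure L) (V : Type)
    (A : set U) (p : set (pform U V)) : Prop :=
  [/\ p `<=` over A, consistent p &
      forall psi, over A psi -> p psi \/ p (Neg psi)].

Definition tp (L : language) (U : structure L) (V : Type) (A : set U)
    (a : V -> U) : set (pform U V) :=
  [set psi | over A psi /\ psat psi a].

Definition global_coheir (L : language) (U : structure L) (V : Type)
    (M : set U) (q p : set (pform U V)) : Prop :=
  [/\ complete_type setT p, q `<=` p & fin_sat_in M p].

(* The finite subtuples of the sequence are compared as tuples indexed by
   ['I_k * 'I_m]. *)
Definition indiscernible (L : language) (U : structure L) (M : set U)
    (m : nat) (b : nat -> 'I_m -> U) : Prop :=
  forall (k : nat) (i j : 'I_k -> nat),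
    {homo i : u v / (u < v)%N} -> {homo j : u v / (u < v)%N} ->
    tp M (fun u : 'I_k * 'I_m => b (i u.1) u.2) =
    tp M (fun u : 'I_k * 'I_m => b (j u.1) u.2).

Definition divides (L : language) (U : structure L) (V : Type) (M : set U)
    (p : set (pform U V)) : Prop :=
  exists (m : nat) (b : nat -> 'I_m -> U) (phi : form L (V + 'I_m)),
    [/\ indiscernible M b,
        entails p (inst_right phi (b 0%N)) &
        ~ consistent [set inst_right phi (b i) | i in [set: nat]]].

Definition card_lt (X Y : Type) (A : set X) (B : set Y) : Prop :=
  A #<= B /\ ~ (B #<= A).

(* Cardinals are represented by types. *)
Definition saturated (L : language) (kappa : Type) (U : structure L) : Prop :=
  forall (A : set U), card_lt A [set: kappa] ->
  forall (n : nat) (p : set (pform U 'I_n)), complete_type A p ->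
    exists a : 'I_n -> U, forall psi, p psi -> psat psi a.

Definition automorphism (L : language) (U : structure L) (s : U -> U) : Prop :=
  [/\ bijective s,
      forall f (x : 'I_(fun_arity f) -> U),
        s (fun_interp x) = fun_interp (fun i => s (x i)) &
      forall r (x : 'I_(rel_arity r) -> U),
        rel_interp (fun i => s (x i)) <-> rel_interp x].

Definition partial_elementary (L : language) (U : structure L) (A : set U)
    (f : U -> U) : Prop :=
  forall n (phi : form L 'I_n) (e : 'I_n -> U), (forall i, A (e i)) ->
    (sat phi e <-> sat phi (fun i => f (e i))).

Definition strongly_homogeneous (L : language) (kappa : Type)
    (U : structure L) : Prop :=
  forall (A : set U) (f : U -> U),
    card_lt A [set: kappa] -> partial_elementary A f ->
    exists s : U -> U, automorphism s /\ forall x, A x -> s x = f x.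

(* The cardinality of L is the number of its formulas in countably many
   variables. *)
Definition monster_model (L : language) (T : theory L) (kappa : Type)
    (U : structure L) : Prop :=
  [/\ models U T, card_lt [set: form L nat] [set: kappa],
      saturated kappa U & strongly_homogeneous kappa U].

(* Main.v *)
(** Let q = tp(b/M). Call an M-definable set S of x's good if S /\ phi(x;y_1) /\ ...
    /\ phi(x;y_k) is consistent for all realizations y_i of q.

    The main step is that "dividing = forking over models" holds in the form: if
    S /\ phi(x;y) does not divide over M, or just if any k0 realizations of q are
    consistent with S for a suitable k0 depending only on phi, then S is good.
    For this one builds, from an inconsistent tuple (c_l) of realizations of q, rows
    of conjugates of (c_l) such that all choices of one coordinate per row have the
    same type over M. If k0 of these were consistent with S, then as each row has a
    coordinate where phi fails, all sign patterns would be realized, contradicting NIP.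
    The rows exist because every type over M has an extension which is at once an heir
    and non-forking; this is proved by the broom argument of Chernikov and Kaplan.

    Let now p be a global coheir of q, given by an ultrafilter F on M. If S is good,
    so is S /\ phi(x;y) for F-almost all y. If S' /\ ~ phi(x;y) were also good for
    F-almost all y and all good S' below S, a tree of such choices would be shattered.
    So S can be shrunk to a good S' such that S' /\ ~ phi(x;y) is not good for F-almost
    all y. Doing this for the countably many coheirs in turn, any a in the intersection
    whose type over M contains only good formulas satisfies phi(a;y) F-almost
    everywhere, for every coheir. *)

From Pilot Require Import Defs.
From mathcomp Require Import all_boot.
From mathcomp Require Import boolp classical_sets functions cardinality filter.
(* [filter] has another [fmap]. *)
Import Pilot.Defs.

Set Implicit Arguments.
Unset Strict Implicit.
Unset Printing Implicit Defensive.

Local Open Scope classical_set_scope.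
Local Open Scope card_scope.

(** * Ultrafilters *)

Record ultra (X : Type) (D : (X -> Prop) -> Prop) : Prop := Ultra {
  ultra_sub : forall P Q : X -> Prop, D P -> (forall x, P x -> Q x) -> D Q;
  ultra_and : forall P Q : X -> Prop, D P -> D Q -> D (fun x => P x /\ Q x);
  ultra_em : forall P : X -> Prop, D P \/ D (fun x => ~ P x);
  ultra_ex : forall P : X -> Prop, D P -> exists x, P x }.

Lemma ultra_of_base (X K : Type) (B : K -> X -> Prop) (k0 : K) :
  (forall k, exists x, B k x) ->
  (forall k l, exists j, forall x, B j x -> B k x /\ B l x) ->
  exists D, ultra D /\ forall k, D (B k).
Proof.
move=> Bex Bdir.
pose F : set_system X := filter_from [set: K] B.
have FF : ProperFilter F.
  apply: filter_from_proper; last by move=> k _; exact: Bex.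
  apply: filter_from_filter; first by exists k0.
  move=> k l _ _; have [j jP] := Bdir k l.
  by exists j => // x /jP [].
have [G [GU FG]] := ultraFilterLemma FF.
exists G; split; last by move=> k; apply: FG; exists k.
split=> [P Q GP PQ|P Q GP GQ|P|P GP].
- exact: filterS GP.
- exact: filterI.
- exact: in_ultra_setVsetC.
- exact: filter_ex GP.
Qed.

Section UltraTheory.
Variables (X : Type) (D : (X -> Prop) -> Prop).
Hypothesis uD : ultra D.

Lemma ultra_true (P : X -> Prop) : (forall x, P x) -> D P.
Proof.
move=> allP; case: (ultra_em uD P) => // /(ultra_ex uD) [x]; by have := allP x.
Qed.

Lemma ultra_not (P : X -> Prop) : D (fun x => ~ P x) <-> ~ D P.
Proof.
split=> [DnP DP|nDP]; last by case: (ultra_em uD P).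
by have [x []] := ultra_ex uD (ultra_and uD DP DnP).
Qed.

Lemma ultra_or (P Q : X -> Prop) : D (fun x => P x \/ Q x) -> D P \/ D Q.
Proof.
move=> DPQ; case: (ultra_em uD P); first by left.
move=> DnP; right; apply: (ultra_sub uD (ultra_and uD DPQ DnP)).
by move=> x [[]].
Qed.

Lemma ultra_forall (J : finType) (P : J -> X -> Prop) :
  (forall j, D (P j)) -> D (fun x => forall j, P j x).
Proof.
move=> DP.
have H (s : seq J) : D (fun x => forall j, j \in s -> P j x).
  elim: s => [|j s IH]; first exact: ultra_true.
  apply: (ultra_sub uD (ultra_and uD (DP j) IH)) => x [Pj Ps] i.
  by rewrite inE => /orP [/eqP ->|/Ps].
by apply: (ultra_sub uD (H (enum J))) => x Px j; apply: Px; rewrite mem_enum.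
Qed.

End UltraTheory.

(** A next element is demanded after every list, also after lists that break the invariant of a
    construction. So users write the invariant into [Q] as an implication and recover it along [f]
    by induction on the length. *)
Lemma dependent_choice_seq (X : Type) (Q : seq X -> X -> Prop) :
  (forall s, exists x, Q s x) ->
  exists f : nat -> X, forall k, Q (mkseq f k) (f k).
Proof.
move=> /choice [c cP].
pose fix g k := if k is k'.+1 then rcons (g k') (c (g k')) else [::].
exists (fun k => c (g k)) => k.
suff -> : mkseq (fun k => c (g k)) k = g k by exact: cP.
by elim: k => //= k IH; rewrite mkseqS IH.
Qed.

(** * Syntax *)

Section Syntax.
Variable L : language.

Lemma tmap_comp (V W X : Type) (g : V -> W) (h : W -> X) (t : term L V) :
  tmap h (tmap g t) = tmap (fun v => h (g v)) t.
Proof. by elim: t => //= f ts IH; congr App; apply: funext. Qed.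

Lemma fmap_comp (V W X : Type) (g : V -> W) (h : W -> X) (phi : form L V) :
  fmap h (fmap g phi) = fmap (fun v => h (g v)) phi.
Proof.
elim: phi W X g h => //=.
- by move=> V' s t W X g h; rewrite !tmap_comp.
- move=> V' r ts W X g h; congr Rel; apply: funext => i; exact: tmap_comp.
- by move=> V' p IHp r IHr W X g h; rewrite IHp IHr.
- move=> V' p IHp W X g h; rewrite IHp; congr (All (fmap _ p)).
  by apply: funext; case.
Qed.

Lemma fmap_id (V : Type) (phi : form L V) : fmap id phi = phi.
Proof.
have tid W (t : term L W) : tmap id t = t.
  by elim: t => //= f ts IH; congr App; apply: funext.
elim: phi => //= [W s t|W r ts|W p -> q ->|W p IH] //; first by rewrite !tid.
  by congr Rel; apply: funext => i; rewrite tid.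
by rewrite -[in RHS]IH; congr (All (fmap _ p)); apply: funext; case.
Qed.

Section Semantics.
Variable N : structure L.

Lemma eval_tmap (V W : Type) (g : V -> W) (e : W -> N) (t : term L V) :
  eval e (tmap g t) = eval (fun v => e (g v)) t.
Proof. by elim: t => //= f ts IH; congr fun_interp; apply: funext. Qed.

Lemma sat_fmap (V W : Type) (g : V -> W) (phi : form L V) (e : W -> N) :
  sat (fmap g phi) e = sat phi (fun v => e (g v)).
Proof.
elim: phi W g e => //=.
- by move=> V' s t W g e; rewrite !eval_tmap.
- by move=> V' r ts W g e; congr rel_interp; apply: funext => i; rewrite eval_tmap.
- by move=> V' p IHp r IHr W g e; rewrite IHp IHr.
- move=> V' p IHp W g e; apply: eq_forall => x; rewrite IHp; congr (sat p _).
  by apply: funext; case.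
Qed.

End Semantics.

Lemma term_support (V : Type) (t : term L V) :
  exists (I : finType) (s : term L I) (g : I -> V),
    forall (N : structure L) (e : V -> N), eval e t = eval (fun i => e (g i)) s.
Proof.
elim: t => [v|f ts IH]; first by exists unit, (Var L tt), (fun _ => v).
have {IH} /choice [F FP] : forall i, exists x : {I : finType & (term L I * (I -> V))%type},
    forall (N : structure L) (e : V -> N),
      eval e (ts i) = eval (fun j => e ((projT2 x).2 j)) (projT2 x).1.
  by move=> i; have [I [s [g gP]]] := IH i; exists (existT _ I (s, g)).
exists {i : 'I_(fun_arity f) & projT1 (F i)}.
exists (App (fun i => tmap (fun j => Tagged (fun i => projT1 (F i) : finType) j)
                           (projT2 (F i)).1)).
exists (fun u => (projT2 (F (tag u))).2 (tagged u)) => N e /=.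
by congr fun_interp; apply: funext => i; rewrite FP eval_tmap.
Qed.

(** Only finitely many variables occur in a formula. In the case of [All], an index sent to [None]
    stands for the bound variable; [v0] is merely a default value for such an index. *)
Lemma form_support (V : Type) (v0 : V) (phi : form L V) :
  exists (I : finType) (psi : form L I) (g : I -> V),
    forall (N : structure L) (e : V -> N),
      sat phi e <-> sat psi (fun i => e (g i)).
Proof.
elim: phi v0 => {V} [V|V s t|V r ts|V p IHp q IHq|V p IHp] v0.
- by exists void, Bot, (fun v : void => match v with end).
- have [I [s' [g gP]]] := term_support s; have [J [t' [h hP]]] := term_support t.
  exists (I + J)%type, (Eq (tmap inl s') (tmap inr t')).
  exists (fun u => match u with inl i => g i | inr j => h j end) => N e /=.
  by rewrite gP hP !eval_tmap.
- have /choice [F FP] : forall i, exists x : {I : finType & (term L I * (I -> V))%type},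
      forall (N : structure L) (e : V -> N),
        eval e (ts i) = eval (fun j => e ((projT2 x).2 j)) (projT2 x).1.
    by move=> i; have [I [s [g gP]]] := term_support (ts i); exists (existT _ I (s, g)).
  exists {i : 'I_(rel_arity r) & projT1 (F i)}.
  exists (Rel (fun i => tmap (fun j => Tagged (fun i => projT1 (F i) : finType) j)
                             (projT2 (F i)).1)).
  exists (fun u => (projT2 (F (tag u))).2 (tagged u)) => N e /=.
  suff -> : (fun i => eval e (ts i)) = (fun i => eval (fun u : {i : 'I_(rel_arity r) &
     projT1 (F i)} => e ((projT2 (F (tag u))).2 (tagged u)))
     (tmap (fun j => Tagged (fun i => projT1 (F i) : finType) j) (projT2 (F i)).1)) by [].
  by apply: funext => i; rewrite FP eval_tmap.
- have [I [s' [g gP]]] := IHp v0; have [J [t' [h hP]]] := IHq v0.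
  exists (I + J)%type, (Imp (fmap inl s') (fmap inr t')).
  exists (fun u => match u with inl i => g i | inr j => h j end) => N e /=.
  by rewrite !sat_fmap gP hP.
- have [I [s [g gP]]] := IHp None.
  exists I, (All (fmap (fun i => if g i is Some _ then Some i else None) s)).
  exists (fun i => if g i is Some v then v else v0) => N e /=.
  have E x : sat p (fun v => if v is Some w then e w else x) <->
    sat (fmap (fun i => if g i is Some _ then Some i else None) s)
      (fun v => if v is Some i then e (if g i is Some v then v else v0) else x).
    rewrite gP sat_fmap.
    suff -> : (fun i => match g i with Some w => e w | None => x end) =
      (fun i => match (if g i is Some _ then Some i else None) with
                | Some i => e (if g i is Some v then v else v0)
                | None => x end) by [].
    by apply: funext => i; case Eg: (g i) => [v|//]; rewrite Eg.
  by split=> H x; apply/E.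
Qed.

Definition ord_void (T : Type) (i : 'I_0) : T := False_rect T (notF (ltn_ord i)).

Fixpoint exs (n : nat) (V : Type) {struct n} : form L (V + 'I_n) -> form L V :=
  match n return form L (V + 'I_n) -> form L V with
  | 0 => fun psi => fmap (fun v => match v with
                                   | inl w => w
                                   | inr i => ord_void V i
                                   end) psi
  | k.+1 => fun psi => Neg (All (Neg (@exs k (option V)
      (fmap (fun v => match v with
                      | inl w => inl (Some w)
                      | inr i => if unlift ord0 i is Some j then inr j else inl None
                      end) psi))))
  end.

Lemma sat_exs (N : structure L) (n : nat) (V : Type) (psi : form L (V + 'I_n)) (e : V -> N) :
  sat (exs psi) e <-> exists a : 'I_n -> N, sat psi (pair_env e a).
Proof.
elim: n V psi e => [|n IH] V psi e /=.
  have Ea (a : 'I_0 -> N) : pair_env e a =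
      (fun v => e match v with inl w => w | inr i => ord_void V i end).
    by apply: funext => -[w//|i]; case: (notF (ltn_ord i)).
  rewrite sat_fmap; split=> [H|[a]]; last by rewrite Ea.
  by exists (@ord_void N); rewrite Ea.
have Ex x (a : 'I_n -> N) :
    (fun v => pair_env (fun w : option V => if w is Some w then e w else x) a
       (match v with
        | inl w => inl (Some w)
        | inr i => if unlift ord0 i is Some j then inr j else inl None end)) =
    pair_env e (fun i => if unlift ord0 i is Some j then a j else x).
  by apply: funext => -[w//|i] /=; case: (unlift ord0 i).
split=> [H|[a Ha] H].
  apply: contrapT => nH; apply: H => x /IH [a].
  rewrite sat_fmap Ex => Ha; apply: nH.
  by exists (fun i => if unlift ord0 i is Some j then a j else x).
apply: (H (a ord0)); apply/IH; exists (fun j => a (lift ord0 j)).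
rewrite sat_fmap Ex; suff -> : (fun i => if unlift ord0 i is Some j
  then a (lift ord0 j) else a ord0) = a by [].
by apply: funext => i; case: unliftP => [j ->|->].
Qed.

End Syntax.

(** * Definable predicates *)

(** The semantic side of a formula over [A]: sets are handled up to equivalence, and closure
    properties replace manipulations of syntax. *)
Definition definable (L : language) (U : structure L) (A : set U) (V : Type)
    (P : (V -> U) -> Prop) : Prop :=
  exists phi : form L (V + A),
    forall e, P e <-> sat phi (pair_env e (fun c : A => val c)).

(* f e is obtained from e by renaming variables and filling in parameters. *)
Definition pullable (L : language) (U : structure L) (A : set U) (V W : Type)
    (f : (W -> U) -> V -> U) : Prop :=
  forall v, (exists w, forall e, f e v = e w) \/
            (exists c, A c /\ forall e, f e v = c).

Section Definable.
Variables (L : language) (U : structure L) (A : set U).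

Lemma definable_ext (V : Type) (P Q : (V -> U) -> Prop) :
  (forall e, P e <-> Q e) -> definable A P -> definable A Q.
Proof. by move=> PQ [phi phiP]; exists phi => e; rewrite -PQ. Qed.

Lemma definable_pull (V W : Type) (f : (W -> U) -> V -> U) (P : (V -> U) -> Prop) :
  pullable A f ->
  definable A P -> definable A (fun e => P (f e)).
Proof.
move=> fP [phi phiP].
have /choice [g gP] : forall v, exists x : (W + A)%type,
    forall e, f e v = pair_env e (fun c : A => val c) x.
  move=> v; case: (fP v) => [[w wP]|[c [Ac cP]]]; first by exists (inl w).
  by exists (inr (exist _ c (mem_set Ac))) => e; rewrite cP.
exists (fmap (fun v => match v with inl v => g v | inr c => inr c end) phi) => e.
rewrite phiP sat_fmap; suff -> : pair_env (f e) (fun c : A => val c) =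
  (fun v => pair_env e (fun c : A => val c)
     (match v with inl v => g v | inr c => inr c end)) by [].
by apply: funext => -[v|c] //=.
Qed.

Lemma definable_sat (V : Type) (phi : form L V) : definable A (@sat L U V phi).
Proof. by exists (fmap inl phi) => e; rewrite sat_fmap. Qed.

Lemma definable_sat_pull (V W : Type) (phi : form L V) (f : (W -> U) -> V -> U) :
  pullable A f ->
  definable A (fun e => sat phi (f e)).
Proof. by move=> fP; apply: definable_pull (definable_sat phi). Qed.

Section Connectives.
Variable V : Type.
Implicit Types P Q : (V -> U) -> Prop.

Lemma definable_imp P Q :
  definable A P -> definable A Q -> definable A (fun e => P e -> Q e).
Proof.
move=> [p pP] [q qP]; exists (Imp p q) => e /=.
by rewrite pP qP.
Qed.

Lemma definable_prop (p : Prop) : definable A (fun _ : V -> U => p).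
Proof.
have [Hp|nHp] := pselect p; last by exists Bot => e; split.
by exists (Imp Bot Bot) => e; split=> // _; exact: id.
Qed.

Lemma definable_not P : definable A P -> definable A (fun e => ~ P e).
Proof. by move=> dP; apply: definable_imp => //; exact: definable_prop. Qed.

Lemma definable_and P Q :
  definable A P -> definable A Q -> definable A (fun e => P e /\ Q e).
Proof.
move=> dP dQ; refine (@definable_ext _ (fun e => ~ (P e -> ~ Q e)) _ _ _).
  move=> e; split=> [H|[Pe Qe] H]; last exact: H.
  split; apply: contrapT => nH; apply: H => //.
by apply/definable_not/definable_imp => //; exact: definable_not.
Qed.

Lemma definable_or P Q :
  definable A P -> definable A Q -> definable A (fun e => P e \/ Q e).
Proof.
move=> dP dQ; refine (@definable_ext _ (fun e => ~ P e -> Q e) _ _ _).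
  move=> e; split=> [H|[Pe|//] //].
  by have [|/H] := pselect (P e); [left|right].
by apply: definable_imp => //; exact: definable_not.
Qed.

Lemma definable_iff P Q :
  definable A P -> definable A Q -> definable A (fun e => P e <-> Q e).
Proof. by move=> dP dQ; apply: definable_and; apply: definable_imp. Qed.

Lemma definable_forall (J : finType) (P : J -> (V -> U) -> Prop) :
  (forall j, definable A (P j)) -> definable A (fun e => forall j, P j e).
Proof.
move=> dP.
have H (s : seq J) : definable A (fun e => forall j, j \in s -> P j e).
  elim: s => [|j s IH].
    by apply: definable_ext (definable_prop True) => e; split.
  apply: definable_ext (definable_and (dP j) IH) => e; split.
    by move=> [Pj Ps] i; rewrite inE => /orP [/eqP ->|/Ps].
  by move=> Ps; split=> [|i si]; apply: Ps; rewrite inE ?eqxx ?si ?orbT.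
apply: definable_ext (H (enum J)) => e.
by split=> He j => [|_]; apply: He; rewrite mem_enum.
Qed.

Lemma definable_exists (J : finType) (P : J -> (V -> U) -> Prop) :
  (forall j, definable A (P j)) -> definable A (fun e => exists j, P j e).
Proof.
move=> dP; refine (@definable_ext _ (fun e => ~ forall j, ~ P j e) _ _ _).
  move=> e; split=> [/existsNP [j /contrapT Pj]|[j Pj] H]; first by exists j.
  exact: (H j).
by apply/definable_not/definable_forall => j; exact: definable_not.
Qed.

End Connectives.

Lemma definable_ex (V : Type) (I : finType) (Q : (V -> U) -> (I -> U) -> Prop) :
  definable A (fun e : V + I -> U => Q (fun v => e (inl v)) (fun i => e (inr i))) ->
  definable A (fun e => exists a, Q e a).
Proof.
move=> [phi phiP].
exists (exs (fmap (fun v => match v with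
  | inl (inl v) => inl (inl v)
  | inl (inr i) => inr (enum_rank i)
  | inr c => inl (inr c) end) phi)) => e.
rewrite sat_exs.
have E (a : 'I_#|I| -> U) (b : I -> U) : (forall i, a (enum_rank i) = b i) ->
  Q e b <-> sat (fmap (fun v => match v with
  | inl (inl v) => inl (inl v)
  | inl (inr i) => inr (enum_rank i)
  | inr c => inl (inr c) end) phi) (pair_env (pair_env e (fun c : A => val c)) a).
  move=> ab; rewrite sat_fmap (phiP (pair_env e b)).
  suff -> : pair_env (pair_env e b) (fun c : A => val c) = (fun v =>
    pair_env (pair_env e (fun c : A => val c)) a match v with
    | inl (inl v) => inl (inl v)
    | inl (inr i) => inr (enum_rank i)
    | inr c => inl (inr c) end) by [].
  by apply: funext => -[[v//|i]|//] /=; rewrite ab.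
split=> [[b Qb]|[a Ha]].
  by exists (fun i => b (enum_val i)); apply/(E _ b) => // i; rewrite enum_rankK.
by exists (fun i => a (enum_rank i)); apply/(E a).
Qed.

Lemma definable_all (V : Type) (I : finType) (Q : (V -> U) -> (I -> U) -> Prop) :
  definable A (fun e : V + I -> U => Q (fun v => e (inl v)) (fun i => e (inr i))) ->
  definable A (fun e => forall a, Q e a).
Proof.
move=> dQ; refine (@definable_ext _ (fun e => ~ exists a, ~ Q e a) _ _ _).
  move=> e; split=> [/forallNP H a|H [a]]; last by apply.
  by apply: contrapT; exact: H.
exact: definable_not (definable_ex (Q := fun e a => ~ Q e a) (definable_not dQ)).
Qed.

End Definable.

Lemma definable_mono (L : language) (U : structure L) (A B : set U) (V : Type)
    (P : (V -> U) -> Prop) : A `<=` B -> definable A P -> definable B P.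
Proof.
move=> AB [phi phiP].
exists (fmap (fun v => match v with inl v => inl v
  | inr c => inr (exist _ (val c) (mem_set (AB _ (set_valP c)))) end) phi) => e.
rewrite phiP sat_fmap; suff -> : pair_env e (fun c : A => val c) = (fun v =>
  pair_env e (fun c : B => val c) (match v with inl v => inl v
  | inr c => inr (exist _ (val c) (mem_set (AB _ (set_valP c)))) end)) by [].
by apply: funext => -[].
Qed.

Section OverVsDefinable.
Variables (L : language) (U : structure L).

Lemma psat_definable (A : set U) (V : Type) (psi : pform U V) :
  over A psi -> definable A (psat psi).
Proof.
move=> [phi ->]; exists phi => e; rewrite /psat sat_fmap.
suff -> : pair_env e (fun c : A => val c) = (fun v => pair_env e id
  match v with inl i => inl i | inr c => inr (val c) end) by [].
by apply: funext => -[].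
Qed.

Lemma definable_psat (A : set U) (V : Type) (P : (V -> U) -> Prop) :
  definable A P -> exists psi : pform U V, over A psi /\ forall e, P e <-> psat psi e.
Proof.
move=> [phi phiP]; set psi := fmap (fun v => match v with
  | inl i => inl i | inr c => inr (val c) end) phi.
exists psi; split; first by exists phi.
move=> e; rewrite phiP /psat sat_fmap.
suff -> : pair_env e (fun c : A => val c) = (fun v => pair_env e id
  match v with inl i => inl i | inr c => inr (val c) end) by [].
by apply: funext => -[].
Qed.

Lemma over_setT (V : Type) (psi : pform U V) : over setT psi.
Proof.
exists (fmap (fun v : V + U => match v with
  | inl i => inl i | inr c => inr (exist _ c (mem_set I) : [set: U]) end) psi).
rewrite fmap_comp -[LHS]fmap_id; congr fmap; by apply: funext => -[].
Qed.

End OverVsDefinable.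

Definition valued (U I : Type) (M : set U) (a : I -> U) : Prop := forall i, M (a i).

(** * Transfer between an elementary substructure and the ambient model *)

Section Elementary.
Variables (L : language) (U : structure L) (M : set U).
Hypothesis eM : elementary_substructure M.

Lemma elementary_sat : exists (M0 : inhabited M) (clM : fun_closed M),
  forall (V : Type) (phi : form L V) (e : V -> induced M0 clM),
    inhabited V -> (sat phi e <-> sat phi (fun v => val (e v) : U)).
Proof.
have [M0 [clM H]] := eM; exists M0, clM => V phi e [v0].
have [I [psi [g gP]]] := form_support v0 phi.
have E (N : structure L) (a : I -> N) :
    sat psi a <-> sat (fmap enum_rank psi) (fun k => a (enum_val k)).
  rewrite sat_fmap; suff -> : (fun i => a (enum_val (enum_rank i))) = a by [].
  by apply: funext => i; rewrite enum_rankK.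
by rewrite !gP !E H.
Qed.

Lemma inhabited_elementary : exists u, M u.
Proof. by have [[u] _] := eM; exists (val u); exact: set_valP. Qed.

(** With its parameters read as free variables, the existential statement can be evaluated in [M] by
    elementarity; a witness found there is carried back to [U]. *)
Lemma tarski_vaught (I : finType) (P : (I -> U) -> Prop) (a : I -> U) :
  definable M P -> P a -> exists m, valued M m /\ P m.
Proof.
have [[u0] [clM H]] := elementary_sat => -[phi phiP] Pa.
set N := induced _ clM in H.
pose psi : form L M := exs (fmap (fun v => match v with
   inl i => inr (enum_rank i) | inr c => inl c end) phi).
have : sat psi (fun c : N => c).
  apply/(H _ _ (fun c : M => c : N)); first by exists.
  apply/sat_exs; exists (fun k => a (enum_val k)); rewrite sat_fmap.
  move/phiP: Pa; congr sat; apply: funext => -[i|//] /=; by rewrite enum_rankK.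
move=> /sat_exs [m]; rewrite sat_fmap.
move=> /(H _ _ _ (inhabits (inr u0))) Hm.
exists (fun i => val (m (enum_rank i))); split; first by move=> i; exact: set_valP.
apply/phiP; move: Hm; congr sat; by apply: funext => -[].
Qed.

End Elementary.

(** * Saturation *)

Lemma countable_range (I : countType) (X : Type) (g : I -> X) : countable (range g).
Proof. exact: card_le_trans (card_image_le _ _) (countableP _). Qed.

Lemma countable_setU (X : Type) (A B : set X) :
  countable A -> countable B -> countable (A `|` B).
Proof.
move=> cA cB; rewrite -bigcup2inE; apply: bigcup_countable; first exact: countableP.
by move=> [|[|[]]].
Qed.

Lemma finite_set_enum (X : Type) (s : set X) : finite_set s ->
  exists (k : nat) (g : 'I_k -> X), forall x, s x -> exists i, g i = x.
Proof.
move=> /finite_setP [k] /card_bijP [f [g fK _]].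
have lt (i : 'I_k) : (i : nat) \in `I_k by apply: mem_set; exact: ltn_ord.
exists k, (fun i : 'I_k => val (g (exist _ (i : nat) (lt i)))) => x sx.
pose y : s := exist _ x (mem_set sx).
have lty : (val (f y) < k)%N := set_valP (f y).
exists (Ordinal lty); rewrite -[x]/(val y) -[in RHS](fK y); congr (val (g _)).
exact: val_inj.
Qed.

(** An ultrafilter on tuples, restricted to the [A]-definable sets, is a complete type over [A]. So
    this says that types over countable sets are realized, in the form in which the constructions
    below produce them. *)
Definition countably_saturated (L : language) (U : structure L) : Prop :=
  forall (I : finType) (A : set U) (D : ((I -> U) -> Prop) -> Prop),
    countable A -> ultra D ->
    exists a, forall P, definable A P -> (P a <-> D P).

Lemma monster_saturated (L : language) (T : theory L) (kappa : Type) (U : structure L) :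
  monster_model T kappa U -> countably_saturated U.
Proof.
move=> [_ [lek nlek] satU _] I A D cA uD.
(* The formulas v_i = v_i are pairwise distinct, so there are infinitely many formulas, and every
   countable set is smaller than [kappa]. *)
have le_nat : [set: nat] #<= [set: form L nat].
  have inj : {in [set: nat] &, injective (fun i => Eq (Var L i) (Var L i))}.
    by move=> i j _ _ [].
  rewrite -(card_le_eql (inj_card_eq inj)); exact: subset_card_le.
have ltA : card_lt A [set: kappa].
  split; first exact: card_le_trans (card_le_trans cA le_nat) lek.
  by move=> leA; apply: nlek; exact: card_le_trans (card_le_trans leA cA) le_nat.
pose tr (a : 'I_#|I| -> U) (i : I) := a (enum_rank i).
pose rt (a : I -> U) (i : 'I_#|I|) := a (enum_val i).
have rtK a : tr (rt a) = a by apply: funext => i; rewrite /tr /rt enum_rankK.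
pose p := [set psi : pform U 'I_#|I| | over A psi /\ D (fun a => psat psi (rt a))].
have cp : complete_type A p.
  split=> [psi []//|s fs sp|psi opsi].
    have : D (fun a => forall psi, s psi -> psat psi (rt a)).
      have [k [g gP]] := finite_set_enum fs.
      have : forall i : 'I_k, D (fun a => s (g i) -> psat (g i) (rt a)).
        move=> i; have [/sp [_ Dg]|ns] := pselect (s (g i)).
          exact: (ultra_sub uD Dg).
        exact: ultra_true.
      move=> /(ultra_forall uD) /(ultra_sub uD); apply=> a Ha psi spsi.
      have [i ig] := gP _ spsi; move: (Ha i); rewrite ig; exact.
    by move=> /(ultra_ex uD) [a Ha]; exists (rt a).
  case: (ultra_em uD (fun a => psat psi (rt a))) => H; [by left|right].
  split; last exact: H.
  case: opsi => psi0 ->; by exists (Neg psi0).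
have [a aP] := satU A ltA _ p cp.
have Dp P : definable A P -> D P -> P (tr a).
  move=> dP DP.
  have /definable_psat [psi [opsi psiP]] : definable A (fun b : 'I_#|I| -> U => P (tr b)).
    by apply: definable_pull dP => i; left; exists (enum_rank i).
  apply/psiP/aP; split=> //; apply: (ultra_sub uD DP) => b Pb.
  by apply/psiP; rewrite rtK.
exists (tr a) => P dP; split=> [Pa|]; last exact: Dp.
by apply: contrapT => /(ultra_not uD) /(Dp _ (definable_not dP)).
Qed.

Lemma saturated_base (L : language) (U : structure L) (I : finType) (A : set U)
    (K : Type) (B : K -> (I -> U) -> Prop) (k0 : K) :
  countably_saturated U -> countable A ->
  (forall k, definable A (B k)) ->
  (forall k, exists a, B k a) ->
  (forall k l, exists j, forall a, B j a -> B k a /\ B l a) ->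
  exists a, forall k, B k a.
Proof.
move=> satU cA dB Bex Bdir.
have [D [uD DB]] := ultra_of_base k0 Bex Bdir.
have [a aP] := satU _ _ _ cA uD.
by exists a => k; apply/aP.
Qed.

(** * Finite VC dimension *)

Definition shattered (Z Y : Type) (R : Z -> Y -> Prop) (k : nat) (y : nat -> Y) : Prop :=
  forall E : nat -> Prop, exists z, forall j, (j < k)%N -> (R z (y j) <-> E j).

Section VC.
Variables (L : language) (T : theory L) (U : structure L).
Hypotheses (nip : NIP T) (modU : models U T) (satU : countably_saturated U).

(** Without a bound, saturation produces an infinite shattered sequence, against NIP. Saturation
    realizes finite tuples only, so the sequence is built term by term, each initial segment being
    kept extendable to shattered sequences of every length. *)
Lemma nip_vc (W : finType) (m : nat) (chi : form L (W + 'I_m)) :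
  exists k, forall y : nat -> 'I_m -> U,
    ~ shattered (fun (z : W -> U) y => sat chi (pair_env z y)) k y.
Proof.
set R := fun (z : W -> U) y => _.
apply: contrapT => /forallNP H.
have {}H k : exists y, shattered R k y.
  by have /existsNP [y /contrapT Hy] := H k; exists y.
have [u0] := carrier_inhabited U.
pose row (s : seq ('I_m -> U)) i := nth (fun _ => u0) s i.
pose ext k s := exists y, (forall i, (i < size s)%N -> y i = row s i) /\ shattered R k y.
have ext_le k l s : (k <= l)%N -> ext l s -> ext k s.
  move=> kl [y [ys Hy]]; exists y; split=> // E.
  by have [z zE] := Hy E; exists z => j jk; apply: zE; exact: leq_trans jk kl.
have ext_def k s : exists A, countable A /\ definable A (fun v => ext k (rcons s v)).
  exists (range (fun p : nat * 'I_m => row s p.1 p.2)); split; first exact: countable_range.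
  (* Row [j] of a possible extension: given by [s] below [size s], equal to [v] at [size s], and
     taken from the quantified [w] above. With finite sign patterns [E], this makes [ext] definable
     in [v]. *)
  pose mix v (w : 'I_k * 'I_m -> U) (j : 'I_k) t :=
    if (j < size s)%N then row s j t else if j == size s :> nat then v t else w (j, t).
  apply: (@definable_ext _ _ _ _ (fun v => exists w : 'I_k * 'I_m -> U,
    forall E : {ffun 'I_k -> bool}, exists z : W -> U,
    forall j : 'I_k, R z (mix v w j) <-> E j)).
    have rowr v j t : row (rcons s v) j t = if (j < size s)%N then row s j t else
        if j == size s then v t else u0.
      by rewrite /row nth_rcons; case: ifP => // _; case: ifP.
    move=> v; split=> [[w Hw]|[y [ys Hy]]].
      exists (fun j => if insub j is Some j' then mix v w j' else row (rcons s v) j).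
      split=> [i|E].
        rewrite size_rcons ltnS => lei; case: insubP => //= j _ ij.
        apply: funext => t; rewrite rowr /mix ij; case: ifP => // lt.
        by rewrite eqn_leq lei leqNgt lt.
      have [z zE] := Hw [ffun j : 'I_k => `[< E j >]].
      exists z => j jk; rewrite insubT /= zE ffunE; split=> [/asboolP//|Ej].
      exact/asboolP.
    exists (fun p : 'I_k * 'I_m => y p.1 p.2) => E.
    have [z zE] := Hy (fun j => if insub j is Some j' then E j' else false).
    exists z => j; have := zE j (ltn_ord j); rewrite (valK j) => <-.
    rewrite (_ : mix v _ j = y j) //; apply: funext => t; rewrite /mix.
    case: ifP => [lt|_]; first by rewrite ys ?rowr ?lt // size_rcons ltnW.
    by case: ifP => // /eqP e; rewrite ys ?rowr e ?ltnn ?eqxx // size_rcons.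
  apply: (@definable_ex _ _ _ _ _ (fun v w => forall E : {ffun 'I_k -> bool}, exists z : W -> U,
    forall j : 'I_k, R z (mix v w j) <-> E j)); lazy beta.
  apply: definable_forall => E.
  apply: (@definable_ex _ _ _ _ _ (fun (e : 'I_m + 'I_k * 'I_m -> U) z =>
    forall j : 'I_k, R z (mix (fun v => e (inl v)) (fun i => e (inr i)) j) <-> E j)); lazy beta.
  apply: definable_forall => j; apply: definable_iff; last exact: definable_prop.
  apply: definable_sat_pull => -[w|t] /=; first by left; exists (inr w).
  rewrite /mix; case: (j < size s)%N; first by right; exists (row s j t);
    split=> //; exists (j : nat, t).
  by left; case: (j == size s :> nat); [exists (inl (inl t))|exists (inl (inr (j, t)))].
have step s : exists v, (forall k, ext k s) -> forall k, ext k (rcons s v).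
  have [ext_s|] := pselect (forall k, ext k s); last by exists (fun _ => u0).
  have /choice [A AP] := fun k => ext_def k s.
  have cA : countable (\bigcup_k A k).
    by apply: bigcup_countable => // k _; have [] := AP k.
  have [|||v vP] := @saturated_base _ U _ (\bigcup_k A k) nat (fun k v => ext k (rcons s v)) 0
    satU cA.
  - by move=> k; have [_] := AP k; apply: definable_mono => x Ax; exists k.
  - move=> k; have [y [ys Hy]] := ext_s k; exists (y (size s)), y; split=> // i.
    rewrite size_rcons ltnS leq_eqVlt /row nth_rcons => /orP [/eqP ->|lt].
      by rewrite ltnn eqxx.
    by rewrite lt ys.
  - move=> k l; exists (maxn k l) => v Hv.
    by split; apply: ext_le Hv; rewrite ?leq_maxl ?leq_maxr.
  by exists v.
have [f fP] := dependent_choice_seq step.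
have fext n k : ext k (mkseq f n).
  elim: n k => [|n IH] k; last by rewrite mkseqS; exact: fP.
  by have [y Hy] := H k; exists y; split.
have fsh k : shattered R k f.
  have [y [yf Hy]] := fext k k => E; have [z zE] := Hy E; exists z => j jk.
  by rewrite -zE // yf ?size_mkseq // /row nth_mkseq.
have /choice [zI zIP] (E : nat -> Prop) : exists z, forall j, R z (f j) <-> E j.
  have [|||z zP] := @saturated_base _ U W (range (fun p : nat * 'I_m => f p.1 p.2)) nat
    (fun k z => forall j : 'I_k, R z (f j) <-> E j) 0 satU (countable_range _).
  - move=> k; apply: definable_forall => i; apply: definable_iff; last exact: definable_prop.
    apply: definable_sat_pull => -[w|t] /=; first by left; exists w.
    by right; exists (f i t); split=> //; exists (i : nat, t).
  - by move=> k; have [z zE] := fsh k E; exists z => i; exact: zE.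
  - move=> k l; exists (maxn k l) => z Hz; split=> i.
      exact: (Hz (widen_ord (leq_maxl k l) i)).
    exact: (Hz (widen_ord (leq_maxr k l) i)).
  by exists z => j; exact: (zP j.+1 ord_max).
(* In [has_IP] the sequence stands on the left, so the two blocks of variables of [chi] are
   exchanged. *)
apply: (nip (phi := fmap (fun v => match v with
  inl w => inr (enum_rank w) | inr t => inl t end) chi)).
exists U, f, (fun E i => zI E (enum_val i)); split=> // i E.
rewrite -zIP /R sat_fmap; suff -> : pair_env (zI E) (f i) = (fun v =>
  pair_env (f i) (fun i => zI E (enum_val i))
   match v with inl w => inr (enum_rank w) | inr t => inl t end) by [].
by apply: funext => -[w|t] //=; rewrite enum_rankK.
Qed.

End VC.

(** * Bounded alternation *)

Section Alternation.
Variables (Y Z : Type) (F : (Y -> Prop) -> Prop).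
Hypothesis uF : ultra F.

(* For k successive F-generic pairs (y', y), no z in S separates y from y' in all of
   them. *)
Fixpoint bounded_alt (E : Z -> Y -> Y -> Prop) (k : nat) (S : Z -> Prop) : Prop :=
  if k is k'.+1 then
    F (fun y' => F (fun y => bounded_alt E k' (fun z => S z /\ ~ E z y y')))
  else ~ exists z, S z.

Lemma bounded_alt_mono E k (S S' : Z -> Prop) :
  (forall z, S z -> S' z) -> bounded_alt E k S' -> bounded_alt E k S.
Proof.
elim: k S S' => [|k IH] S S' SS' /=; first by move=> H [z /SS' Sz]; apply: H; exists z.
move=> /(ultra_sub uF); apply=> y' /(ultra_sub uF); apply=> y; apply: IH.
by move=> z [/SS'].
Qed.

Lemma bounded_alt_or E k (S1 S2 : Z -> Prop) :
  bounded_alt E k S1 -> bounded_alt E k S2 ->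
  bounded_alt E k (fun z => S1 z \/ S2 z).
Proof.
elim: k S1 S2 => [|k IH] S1 S2 /=.
  by move=> H1 H2 [z [Sz|Sz]]; [apply: H1|apply: H2]; exists z.
move=> H1 H2; apply: (ultra_sub uF (ultra_and uF H1 H2)) => y' [{}H1 {}H2].
apply: (ultra_sub uF (ultra_and uF H1 H2)) => y [{}H1 {}H2].
by apply: bounded_alt_mono (IH _ _ H1 H2) => z [[]]; [left|right].
Qed.

Lemma bounded_alt_empty E k (S : Z -> Prop) : ~ (exists z, S z) -> bounded_alt E k S.
Proof.
elim: k S => [//|k IH] S nS /=.
apply: ultra_true => // y'; apply: ultra_true => // y.
by apply: IH => -[z [Sz _]]; apply: nS; exists z.
Qed.

(** If z violates the conjunction at a pair, it violates [E1] or [E2] there, which uses up one of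
    the [k1] or [k2] violations allowed; hence the induction on the sum. *)
Lemma bounded_alt_and (E1 E2 : Z -> Y -> Y -> Prop) k1 k2 (S : Z -> Prop) :
  bounded_alt E1 k1 S -> bounded_alt E2 k2 S ->
  bounded_alt (fun z y y' => E1 z y y' /\ E2 z y y') (k1 + k2) S.
Proof.
have [n le_n] := ubnP (k1 + k2); elim: n => // n IH in k1 k2 S le_n *.
case: k1 => [|k1] in le_n *; first by move=> nS _; exact: bounded_alt_empty.
case: k2 => [|k2] in le_n *; first by move=> _ nS; exact: bounded_alt_empty.
rewrite ltnS addSn addnS in le_n.
rewrite addSn => H1 H2 /=.
apply: (ultra_sub uF (ultra_and uF H1 H2)) => y' [H1' H2'].
apply: (ultra_sub uF (ultra_and uF H1' H2')) => y [{}H1' {}H2'].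
apply: (@bounded_alt_mono _ _ _ (fun z => (S z /\ ~ E1 z y y') \/ (S z /\ ~ E2 z y y'))).
  by move=> z [Sz /not_andP [nE|nE]]; [left|right].
apply: bounded_alt_or.
  apply: IH => //; first by rewrite addnS.
  by apply: bounded_alt_mono H2 => z [].
rewrite addnS -addSn; apply: IH => //.
by apply: bounded_alt_mono H1 => z [].
Qed.

Variable R : Z -> Y -> Prop.

Fixpoint generic_sign (s : seq bool) (S : Z -> Prop) : Prop :=
  if s is b :: s' then F (fun y => generic_sign s' (fun z => S z /\ (R z y <-> b)))
  else exists z, S z.

Lemma generic_sign_or s (S S1 S2 : Z -> Prop) :
  (forall z, S z -> S1 z \/ S2 z) ->
  generic_sign s S -> generic_sign s S1 \/ generic_sign s S2.
Proof.
elim: s S S1 S2 => [|b s IH] S S1 S2 SS /=.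
  by move=> [z /SS [Sz|Sz]]; [left|right]; exists z.
move=> H; apply: (ultra_or uF); apply: (ultra_sub uF H) => y; apply: IH.
by move=> z [/SS [Sz|Sz] Rz]; [left|right].
Qed.

(** If the first alternative fails, then for generic y' and then generic y, all patterns of length k
    occur on the z in [S] that separate y from y'. Such a z has the sign [b] at y or at y', so by
    [generic_sign_or] one of the two points can begin the pattern. *)
Lemma bounded_alt_dichotomy k (S : Z -> Prop) :
  bounded_alt (fun z y y' => R z y <-> R z y') k S \/
  forall s, size s = k -> generic_sign s S.
Proof.
elim: k S => [|k IH] S /=.
  have [H|H] := pselect (exists z, S z); [right|by left].
  by move=> s /size0nil ->.
set Q := (X in X \/ _); have [|nQ] := pselect Q; [by left|right].
move=> [//|b s] [sk] /=; set B := fun y => _.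
have constF (p : Prop) : F (fun _ => p) -> p by move=> /(ultra_ex uF) [].
have : F (fun y' => F B \/ B y').
  move/(ultra_not uF): nQ => /(ultra_sub uF); apply=> y' /(ultra_not uF) nQ.
  have : F (fun y => B y \/ B y').
    apply: (ultra_sub uF nQ) => y nb.
    have [//|/(_ s sk)] := IH (fun z => S z /\ ~ (R z y <-> R z y')).
    apply: generic_sign_or => z [Sz nR].
    have [Ry|nRy] := pselect (R z y <-> b); [by left|right; split=> //].
    have tt' : is_true true by []; have ff : ~ is_true false by [].
    by case: b {B} nRy => nRy; have [r|r] := pselect (R z y);
      have [r'|r'] := pselect (R z y'); tauto.
  by move=> /(ultra_or uF) [|/constF]; [left|right].
by move=> /(ultra_or uF) [/constF|].
Qed.

(** One y must serve all [S j] at once, which a finite intersection in [F] provides. After each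
    choice the family doubles, with one member for each sign at the new point. *)
Lemma generic_sign_shattered k (J : finType) (S : J -> Z -> Prop) :
  (forall j (s : k.-tuple bool), generic_sign s (S j)) ->
  exists y : nat -> Y, forall j (E : nat -> Prop),
    exists z, S j z /\ forall i, (i < k)%N -> (R z (y i) <-> E i).
Proof.
elim: k J S => [|k IH] J S HS.
  have [y0 _] : exists y : Y, True by apply: (ultra_ex uF); exact: ultra_true.
  exists (fun _ => y0) => j E; have [z Sz] := HS j [tuple]; by exists z.
have : F (fun y => forall p : (J * bool) * k.-tuple bool,
    generic_sign p.2 (fun z => S p.1.1 z /\ (R z y <-> p.1.2))).
  by apply: ultra_forall => // -[[j b] s]; exact: (HS j [tuple of b :: s]).
move=> /(ultra_ex uF) [y0 Hy0].
have [//|y yP] := IH (J * bool)%type (fun p z => S p.1 z /\ (R z y0 <-> p.2)).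
  by move=> p s; exact: (Hy0 (p, s)).
exists (fun i => if i is i'.+1 then y i' else y0) => j E.
have [z [[Sz R0] Rz]] := yP (j, `[< E 0 >]) (fun i => E i.+1).
exists z; split=> // -[|i] ik; last exact: Rz.
by rewrite R0 /=; split=> [/asboolP|H]; last exact/asboolP.
Qed.

Lemma vc_bounded_alt k :
  (forall y, ~ shattered R k y) ->
  bounded_alt (fun z y y' => R z y <-> R z y') k (fun _ => True).
Proof.
move=> nsh; case: (bounded_alt_dichotomy k (fun _ => True)) => // H.
have [//|y yP] := @generic_sign_shattered k unit (fun _ _ => True).
  by move=> _ s; apply: H; rewrite size_tuple.
by case: (nsh y) => E; have [z [_ Hz]] := yP tt E; exists z.
Qed.

End Alternation.

(** * Monochromatic tuples in the model *)

Definition equiv_over (L : language) (U : structure L) (A : set U) (I : Type)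
    (a a' : I -> U) : Prop :=
  forall P, definable A P -> (P a <-> P a').

Fixpoint agree (L : language) (U : structure L) (W Y : Type) (cs : seq (form L (W + Y)))
    (z : W -> U) (y y' : Y -> U) : Prop :=
  if cs is c :: cs' then
    (sat c (pair_env z y) <-> sat c (pair_env z y')) /\ agree cs' z y y'
  else True.

Section Agree.
Variables (L : language) (U : structure L) (W Y : Type) (cs : seq (form L (W + Y))).
Implicit Types (z : W -> U) (y : Y -> U).

Lemma agree_sym z y y' : agree cs z y y' -> agree cs z y' y.
Proof. by elim: cs => //= c s IH [E /IH H]; split; first by rewrite E. Qed.

Lemma agree_trans z y1 y2 y3 : agree cs z y1 y2 -> agree cs z y2 y3 -> agree cs z y1 y3.
Proof. by elim: cs => //= c s IH [E1 H1] [E2 H2]; split; [rewrite E1|exact: IH]. Qed.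

Lemma agree_definable (A : set U) (V : Type) (fz : (V -> U) -> W -> U)
    (fy fy' : (V -> U) -> Y -> U) :
  pullable A fz -> pullable A fy -> pullable A fy' ->
  definable A (fun e => agree cs (fz e) (fy e) (fy' e)).
Proof.
move=> pz py py'; elim: cs => [|c s IH] /=; first exact: definable_prop.
apply: definable_and => //; apply: definable_iff.
  by apply: definable_sat_pull => -[v|v]; [exact: pz|exact: py].
by apply: definable_sat_pull => -[v|v]; [exact: pz|exact: py'].
Qed.

End Agree.

Section Elementary.
Variables (L : language) (U : structure L) (M : set U).
Hypothesis eM : elementary_substructure M.

(** The [M]-definable sets containing [a] are closed under intersection and meet [M] by
    [tarski_vaught]. The ultrafilter obtained plays the role of a global coheir of tp(a/M). *)
Lemma coheir_ultra (I : finType) (a : I -> U) :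
  exists F, [/\ ultra F, F (valued M) & forall P, definable M P -> P a -> F P].
Proof.
pose K := {P : (I -> U) -> Prop | definable M P /\ P a}.
have kT : K by exists (fun _ => True); split=> //; exact: definable_prop.
have [|[P [dP Pa]] [Q [dQ Qa]]|F [uF FB]] :=
  @ultra_of_base _ K (fun k m => valued M m /\ sval k m) kT.
- by move=> [P [dP Pa]]; exact: (tarski_vaught eM dP Pa).
- have dPQ : definable M (fun e => P e /\ Q e) /\ (P a /\ Q a).
    by split=> //; exact: definable_and.
  by exists (exist (fun P => definable M P /\ P a) _ dPQ) => x /= [? []].
exists F; split=> // [|P dP Pa].
  by apply: (ultra_sub uF (FB kT)) => x [].
have kP : definable M P /\ P a by [].
by apply: (ultra_sub uF (FB (exist (fun P => definable M P /\ P a) _ kP))) => x [].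
Qed.

Lemma ultra_equiv (I : Type) (a : I -> U) (F : ((I -> U) -> Prop) -> Prop) (A : set U) P :
  ultra F -> (forall P, definable A P -> P a -> F P) -> definable A P -> (P a <-> F P).
Proof.
move=> uF FP dP; split; first exact: FP.
by move=> FPP; apply: contrapT => /(FP _ (definable_not dP)) /(ultra_not uF).
Qed.

End Elementary.

Lemma agree_bounded_alt (L : language) (T : theory L) (U : structure L) (m : nat)
    (F : (('I_m -> U) -> Prop) -> Prop) (W : finType)
    (cs : seq (form L (W + 'I_m))) :
  NIP T -> models U T -> countably_saturated U -> ultra F ->
  exists k, bounded_alt F (@agree L U W _ cs) k (fun _ => True).
Proof.
move=> nip modU satU uF; elim: cs => [|chi s [k2 H2]].
  exists 1 => /=; apply: ultra_true => // y'; apply: ultra_true => // y.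
  by move=> [z [_]].
have [k1 H1] := nip_vc nip modU satU chi.
exists (k1 + k2); exact: bounded_alt_and (vc_bounded_alt _ _) _.
Qed.

(** * The broom argument *)

Section Broom.
Variables (L : language) (T : theory L) (U : structure L) (M : set U).
Hypotheses (nip : NIP T) (modU : models U T) (satU : countably_saturated U).
Hypotheses (eM : elementary_substructure M) (cM : countable M).
Variables (m r : nat) (b : 'I_m -> U) (c : 'I_r -> 'I_m -> U).
Hypothesis cb : forall l, equiv_over M (c l) b.
Variable alpha : ('I_r * 'I_m -> U) -> Prop.
Hypotheses (dalpha : definable M alpha) (alphac : alpha (fun p => c p.1 p.2)).
Variables (W : finType) (cs : seq (form L (W + 'I_m))).

Let mono (z : W -> U) (y : 'I_r * 'I_m -> U) : Prop :=
  forall l l', agree cs z (fun t => y (l, t)) (fun t => y (l', t)).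

(** The s tuples do not depend on z. In the proof the exceptional set [S] is removed step by step,
    at the price of a larger [s]. *)
Let cov (s : nat) (S : (W -> U) -> Prop) : Prop :=
  exists y : 'I_s * ('I_r * 'I_m) -> U, (forall i, alpha (fun p => y (i, p))) /\
    forall z, S z \/ exists i, mono z (fun p => y (i, p)).

(* In a block (c, d), slot [Some l] carries c_l, slot [None] carries d. *)
Let sep (n : nat) (z : W -> U) (a : option 'I_r * 'I_m -> U) : Prop :=
  exists l : 'I_r, (l < n)%N /\
    ~ agree cs z (fun t => a (Some l, t)) (fun t => a (None, t)).

Let cov_mono s (S S' : (W -> U) -> Prop) :
  (forall z, S z -> S' z) -> cov s S -> cov s S'.
Proof.
move=> SS' [y [ay Hy]]; exists y; split=> // z.
by case: (Hy z) => [/SS'|]; [left|right].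
Qed.

Let cov_add s s' (S S' : (W -> U) -> Prop) :
  cov s S -> cov s' S' -> cov (s + s') (fun z => S z /\ S' z).
Proof.
move=> [y [ay Hy]] [y' [ay' Hy']].
exists (fun p : 'I_(s + s') * _ => match fintype.split p.1 with
  | inl i => y (i, p.2) | inr i => y' (i, p.2) end).
split=> [i|z] /=; first by case: (fintype.split i).
case: (Hy z) => [Sz|[i Hi]]; last first.
  by right; exists (lshift s' i) => l l' /=; rewrite (unsplitK (inl i)); exact: Hi.
case: (Hy' z) => [S'z|[i Hi]]; first by left.
by right; exists (rshift s i) => l l' /=; rewrite (unsplitK (inr i)); exact: Hi.
Qed.

Let cov_definable (V : Type) s (S : (V -> U) -> (W -> U) -> Prop) :
  definable M (fun e : V + W -> U => S (fun v => e (inl v)) (fun w => e (inr w))) ->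
  definable M (fun e => cov s (S e)).
Proof.
move=> dS; rewrite /cov.
apply: (@definable_ex _ _ _ _ _ (fun e (y : 'I_s * ('I_r * 'I_m) -> U) =>
  (forall i, alpha (fun p => y (i, p))) /\
    forall z, S e z \/ exists i, mono z (fun p => y (i, p)))).
apply: definable_and.
  apply: definable_forall => i; apply: (definable_pull _ dalpha) => p.
  by left; exists (inr (i, p)).
apply: (@definable_all _ _ _ _ _ (fun (e : V + 'I_s * ('I_r * 'I_m) -> U) z =>
  S (fun v => e (inl v)) z \/ exists i, mono z (fun p => e (inr (i, p))))); lazy beta.
apply: definable_or.
  have := definable_pull (f := fun (e : (V + 'I_s * ('I_r * 'I_m)) + W -> U) v =>
    match v with inl v => e (inl (inl v)) | inr w => e (inr w) end) _ dS; apply.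
  by move=> -[v|w]; left; [exists (inl (inl v))|exists (inr w)].
apply: definable_exists => i; apply: definable_forall => l; apply: definable_forall => l'.
apply: agree_definable => t; left; first by exists (inr t).
  by exists (inl (inr (i, (l, t)))).
by exists (inl (inr (i, (l', t)))).
Qed.

Let sep_definable n (V : Type) (fz : (V -> U) -> W -> U)
    (fa : (V -> U) -> option 'I_r * 'I_m -> U) :
  pullable M fz -> pullable M fa -> definable M (fun e => sep n (fz e) (fa e)).
Proof.
move=> pz pa; apply: definable_exists => l; apply: definable_and; first exact: definable_prop.
apply: definable_not; apply: agree_definable => // t; exact: pa.
Qed.

(* Broom argument: [elim_sep] removes the formulas "z separates c_l from d" one l at a
   time. Removing one replaces the block by several generic copies whose slots l and
   [None] both follow F, so that z cannot separate them in every copy; the other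
   separating formulas of these copies are then removed from the last copy on. *)
Lemma mono_in_model (z0 : W -> U) :
  exists y, [/\ valued M y, alpha y & mono z0 y].
Proof.
have [F [uF FM Fb]] := coheir_ultra eM b.
have [k nb] := agree_bounded_alt cs nip modU satU uF.
pose A := M `|` range (fun p : 'I_r * 'I_m => c p.1 p.2).
have cA : countable A by apply: countable_setU => //; exact: countable_range.
have [d dP] := satU cA uF.
pose a (p : option 'I_r * 'I_m) := if p.1 is Some l then c l p.2 else d p.2.
(* [R] extends the type over [M] of the block [a] = (c, d), while its slots [None] and [l] behave
   like a generic pair for [F], the slot [None] being chosen first. *)
have elim_step (l : 'I_r) : exists R, [/\ ultra R, R (valued M),
    (forall P, definable M P -> P a -> R P) &
    forall Q : ('I_m -> U) -> ('I_m -> U) -> Prop, F (fun y' => F (fun y => Q y y')) ->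
      R (fun x => Q (fun t => x (Some l, t)) (fun t => x (None, t)))].
  pose K := ({P : (option 'I_r * 'I_m -> U) -> Prop | definable M P /\ P a} *
    {Q : ('I_m -> U) -> ('I_m -> U) -> Prop | F (fun y' => F (fun y => Q y y'))})%type.
  have FT : F (fun y' => F (fun y => (fun _ _ => True) y y')).
    by apply: ultra_true => // y; exact: ultra_true.
  pose kF := exist (fun Q : ('I_m -> U) -> ('I_m -> U) -> Prop =>
    F (fun y' => F (fun y => Q y y'))) _ FT.
  have kT : {P : (option 'I_r * 'I_m -> U) -> Prop | definable M P /\ P a}.
    by exists (fun _ => True); split=> //; exact: definable_prop.
  have [|[[P [dP' Pa]] [Q HQ]] [[P' [dP'' P'a]] [Q' HQ']]|R [uR RB]] :=
    @ultra_of_base _ K (fun k x => [/\ valued M x, sval k.1 x &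
      sval k.2 (fun t => x (Some l, t)) (fun t => x (None, t))]) (kT, kF).
  - move=> [[P [dP' Pa]] [Q HQ]] /=.
    pose asm (y y' : 'I_m -> U) (x : option 'I_r * 'I_m -> U) (p : option 'I_r * 'I_m) :=
      if p.1 is Some l' then if l' == l then y p.2 else x p else y' p.2.
    pose G y y' := exists x, P (asm y y' x).
    have asmA B (V : Type) (f f' : (V -> U) -> 'I_m -> U) (g : (V -> U) -> _) :
        pullable B f -> pullable B f' -> pullable B g ->
        pullable B (fun e => asm (f e) (f' e) (g e)).
      by move=> pf pf' pg [[l'|] t]; rewrite /asm /=; [case: eqP => _|].
    have dG B (V : Type) (f f' : (V -> U) -> 'I_m -> U) : M `<=` B ->
        pullable B f -> pullable B f' -> definable B (fun e => G (f e) (f' e)).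
      move=> MB pf pf'.
      apply: (@definable_ex _ _ _ _ _ (fun e x => P (asm (f e) (f' e) x))).
      apply: definable_pull (definable_mono MB dP').
      apply: asmA => [v|v|p]; last by left; exists (inr p).
        by case: (pf v) => [[w Hw]|[u [Bu Hu]]]; [left; exists (inl w)|right; exists u].
      by case: (pf' v) => [[w Hw]|[u [Bu Hu]]]; [left; exists (inl w)|right; exists u].
    (* As [d] realizes [F] over [M] and the c_l, [G (c l)] holds for F-most y'. For such y' in [M]
       the condition on y is over [M], so it passes from [c l] to [b] and then to F-most y. *)
    have FFG : F (fun y' => F (fun y => G y y')).
      have : F (fun y' => G (c l) y').
        have dGc : definable A (fun y' => G (c l) y').
          apply: (dG A _ (fun _ => c l) (fun e => e)) => [u Mu|t|t].
          - by left.
          - by right; exists (c l t); split=> //; right; exists (l, t).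
          - by left; exists t.
        apply/(dP _ dGc).
        exists a; rewrite (_ : asm _ _ _ = a) //; apply: funext => -[[l'|] t] //.
        by rewrite /asm /=; case: eqP => // ->.
      move=> GF; apply: (ultra_sub uF (ultra_and uF FM GF)) => y' [My' Gy'].
      have dGy : definable M (fun y => G y y').
        by apply: (dG M _ (fun e => e) (fun _ => y')) => // t;
          [left; exists t|right; exists (y' t)].
      by apply: (Fb _ dGy); apply/(cb l dGy).
    have : F (fun y' => F (fun y => (Q y y' /\ G y y') /\ valued M y)).
      apply: (ultra_sub uF (ultra_and uF HQ FFG)) => y' [Q1 G1].
      by apply: (ultra_and uF) => //; exact: (ultra_and uF).
    move=> /(ultra_and uF FM) /(ultra_ex uF) [y' [My' /(ultra_ex uF) [y [[Qy [x Px]] My]]]].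
    have dx : definable M (fun x => P (asm y y' x)).
      apply: (definable_pull (asmA M _ (fun _ => y) (fun _ => y') id _ _ _) dP') => t.
        by right; exists (y t).
        by right; exists (y' t).
      by left; exists t.
    have [x' [Mx' Px']] := tarski_vaught eM dx Px.
    exists (asm y y' x'); split=> //.
      by move=> [[l'|] t]; rewrite /asm /=; [case: eqP|].
    rewrite (_ : (fun t => asm y y' x' (Some l, t)) = y) //.
    by apply: funext => t; rewrite /asm /= eqxx.
  - have dPP : definable M (fun e => P e /\ P' e) /\ (P a /\ P' a).
      by split=> //; exact: definable_and.
    have FQQ : F (fun y' => F (fun y => Q y y' /\ Q' y y')).
      apply: (ultra_sub uF (ultra_and uF HQ HQ')) => y' [Q1 Q2].
      exact: (ultra_and uF).
    exists (exist (fun P => definable M P /\ P a) _ dPP,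
      exist (fun Q => F (fun y' => F (fun y => Q y y'))) _ FQQ).
    by move=> x /= [? [? ?] [? ?]].
  exists R; split=> //.
  - by apply: (ultra_sub uR (RB (kT, kF))) => x [].
  - move=> P dP' Pa; have dPP : definable M P /\ P a by [].
    by apply: (ultra_sub uR (RB (exist (fun P => definable M P /\ P a) _ dPP, kF))) => x [].
  - move=> Q HQ.
    by apply: (ultra_sub uR (RB (kT,
      exist (fun Q => F (fun y' => F (fun y => Q y y'))) _ HQ))) => x [].
(* The bound [S] is uniform in [Th]. Below, [Th] acquires parameters from a block x, and only for a
   fixed number of tuples is the covering statement a definable property of x that transfers between
   x and [a]. *)
have elim_sep n : (n <= r)%N -> forall s, exists S, forall Th, definable M Th ->
    cov s (fun z => Th z \/ sep n z a) -> cov S Th.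
  elim: n => [|n IHn] nr s.
    by exists s => Th dTh; apply: cov_mono => z [//|[l []]].
  have [R [uR RM Ra RQ]] := elim_step (Ordinal nr).
  have sepS z x : sep n.+1 z x -> sep n z x \/
      ~ agree cs z (fun t => x (Some (Ordinal nr), t)) (fun t => x (None, t)).
    move=> [l []]; rewrite ltnS leq_eqVlt => /orP [/eqP ln nA|ln nA].
      by right; rewrite (_ : Ordinal nr = l) //; exact: val_inj.
    by left; exists l.
  have dcov n' s' Th : definable M Th ->
      definable M (fun x => cov s' (fun z => Th z \/ sep n' z x)).
    move=> dTh; apply: (@cov_definable _ s' (fun x z => Th z \/ sep n' z x)).
    apply: definable_or; first by apply: (definable_pull _ dTh) => w; left; exists (inr w).
    by apply: sep_definable => w; left; [exists (inr w)|exists (inl w)].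
  (* Induction on the alternation bound [k'] of the exceptional set [S']. An R-generic copy x of the
     block reduces [S'] to the z separating slot [n] of x from [None], which lowers [k']; the other
     separations by x join [Th] until [IHn] removes them. *)
  suff C k' u : exists S, forall Th S', definable M Th -> bounded_alt F (agree cs) k' S' ->
      cov s (fun z => Th z \/ sep n.+1 z a) -> cov u (fun z => Th z \/ S' z) -> cov S Th.
    have [S HS] := C k 0; exists S => Th dTh covT; apply: (HS _ _ dTh nb covT).
    by exists (fun p : 'I_0 * ('I_r * 'I_m) => ord_void U p.1); split=> [[]//|z]; left; right.
  elim: k' u => [|k' IHk] u.
    by exists u => Th S' dTh nS' _; apply: cov_mono => z [//|Sz]; case: nS'; exists z.
  have [S1 HS1] := IHk (u + s); have [S HS] := IHn (ltnW nr) S1.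
  exists S => Th S' dTh /= /RQ RS' covs covu; apply: HS => //.
  apply/(ultra_equiv uR Ra (dcov _ _ _ dTh)).
  have Rcov := Ra _ (dcov _ _ _ dTh) covs.
  apply: (ultra_sub uR (ultra_and uR RM (ultra_and uR RS' Rcov))) => x [Mx [nbx covx]].
  apply: HS1 nbx _ _.
  - apply: definable_or => //; apply: sep_definable => w; first by left; exists w.
    by right; exists (x w).
  - by apply: cov_mono covs => z [Tz|sz]; [left; left|right].
  - apply: cov_mono (cov_add covu covx) => z [[Tz|Sz] [Tz'|]]; try by left; left.
    by move=> /sepS [sz|nA]; [left; right|right].
(* To start, one tuple suffices: if z separates no c_l from [d], it sees all c_l alike, so [c]
   itself is monochromatic. *)
have [S HS] := elim_sep r (leqnn r) 1.
have [|y [ay Hy]] := HS (fun _ => False) (definable_prop _ _ _).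
  exists (fun p => c p.2.1 p.2.2); split=> // z.
  have [sz|nsz] := pselect (sep r z a); [by left; right|right].
  have ag l : agree cs z (fun t => c l t) d.
    by apply: contrapT => nA; apply: nsz; exists l; split.
  exists ord0 => l l' /=; apply: agree_trans (ag l) _; exact: agree_sym.
(* A finite family serving every z simultaneously is described over [M], hence exists in [M]. Only
   then is [z0], whose entries may lie outside [M], inserted. *)
have dy : definable M (fun y : 'I_S * ('I_r * 'I_m) -> U =>
    (forall i, alpha (fun p => y (i, p))) /\
    forall z, exists i, mono z (fun p => y (i, p))).
  apply: definable_and.
    apply: definable_forall => i; apply: (definable_pull _ dalpha) => p.
    by left; exists (i, p).
  apply: (@definable_all _ _ _ _ _ (fun (e : 'I_S * ('I_r * 'I_m) -> U) z =>
    exists i, mono z (fun p => e (i, p)))); lazy beta.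
  apply: definable_exists => i; apply: definable_forall => l; apply: definable_forall => l'.
  by apply: agree_definable => t; left;
    [exists (inr t)|exists (inl (i, (l, t)))|exists (inl (i, (l', t)))].
have [|y' [My' [ay' Hy']]] := tarski_vaught eM dy (a := y).
  by split=> // z; case: (Hy z).
have [i Hi] := Hy' z0.
by exists (fun p => y' (i, p)); split.
Qed.

End Broom.

(** * Strict arrays *)

Lemma agree_fmap (L : language) (U : structure L) (W W' Y : Type)
    (cs : seq (form L (W + Y))) (h : W -> W') (z : W' -> U) (y y' : Y -> U) :
  agree (map (fmap (fun v => match v with inl w => inl (h w) | inr t => inr t end)) cs) z y y'
  <-> agree cs (fun w => z (h w)) y y'.
Proof.
have E (x : Y -> U) : (fun v : W + Y => pair_env z x
    match v with inl w => inl (h w) | inr t => inr t end) = pair_env (fun w => z (h w)) x.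
  by apply: funext => -[].
by elim: cs => //= c cs IH; rewrite !sat_fmap !E IH.
Qed.

Definition set_slot (U : Type) (m k : nat) (e : nat * 'I_m -> U) (v : 'I_m -> U)
    (p : nat * 'I_m) : U :=
  if p.1 == k then v p.2 else e p.

Section Slots.
Variables (L : language) (U : structure L) (A : set U) (m k : nat).

Lemma definable_set_slotl (v : 'I_m -> U) (P : (nat * 'I_m -> U) -> Prop) :
  valued A v -> definable A P -> definable A (fun e => P (set_slot k e v)).
Proof.
move=> Av; apply: definable_pull => p; rewrite /set_slot.
by case: (p.1 == k); [right; exists (v p.2)|left; exists p].
Qed.

Lemma definable_set_slotr (e : nat * 'I_m -> U) (P : (nat * 'I_m -> U) -> Prop) :
  valued A e -> definable A P -> definable A (fun v => P (set_slot k e v)).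
Proof.
move=> Ae; apply: definable_pull => p; rewrite /set_slot.
by case: (p.1 == k); [left; exists p.2|right; exists (e p)].
Qed.

End Slots.

Section Strict.
Variables (L : language) (T : theory L) (U : structure L) (M : set U).
Hypotheses (nip : NIP T) (modU : models U T) (satU : countably_saturated U).
Hypotheses (eM : elementary_substructure M) (cM : countable M).
Variables (m r : nat) (b : 'I_m -> U) (c : 'I_r -> 'I_m -> U).
Hypothesis cb : forall l, equiv_over M (c l) b.

Let same (P : ('I_m -> U) -> Prop) (x : 'I_r * 'I_m -> U) : Prop :=
  forall l l', P (fun t => x (l, t)) <-> P (fun t => x (l', t)).

(** By [mono_in_model], tuples in [M] satisfy any formula of the type of [c] over [M] together with
    agreement of the columns on finitely many sets over [A]. An ultrafilter containing these
    conditions is realized over [A]; it concentrates on [M], whence the last clause. *)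
Lemma strict_tuple (A : set U) : M `<=` A -> countable A ->
  exists y : 'I_r * 'I_m -> U, [/\ equiv_over M y (fun p => c p.1 p.2),
    (forall P, definable A P -> same P y) &
    (forall Q, definable A Q -> Q y -> exists x, valued M x /\ Q x)].
Proof.
move=> MA cA.
have [u0 Mu0] := inhabited_elementary eM.
pose sames := fix sames (s : seq {P : ('I_m -> U) -> Prop | definable A P}) x :=
  if s is P :: s' then same (sval P) x /\ sames s' x else True.
(* The parameters of finitely many [A]-definable sets are collected in one tuple [z0], as
   [mono_in_model] requires. *)
have pack s : exists (W : finType) (z0 : W -> U) (cs : seq (form L (W + 'I_m))),
    forall x : 'I_r * 'I_m -> U,
      (forall l l', agree cs z0 (fun t => x (l, t)) (fun t => x (l', t))) -> sames s x.
  elim: s => [|[P [phi phiP]] s [W [z0 [cs csP]]]] /=.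
    by exists unit, (fun _ => u0), [::].
  have [I [psi [g gP]]] := form_support (inr (exist _ u0 (mem_set (MA _ Mu0)))) phi.
  pose z1 i := if g i is inr u then val u else u0.
  exists (I + W)%type, (pair_env z1 z0), (fmap (fun i => match g i with
      inl t => inr t | inr _ => inl (inl i) end) psi ::
    map (fmap (fun v => match v with inl w => inl (inr w) | inr t => inr t end)) cs).
  have E (y : 'I_m -> U) : P y <-> sat (fmap (fun i => match g i with
      inl t => inr t | inr _ => inl (inl i) end) psi) (pair_env (pair_env z1 z0) y).
    rewrite phiP gP sat_fmap; suff -> : (fun i => pair_env y (fun u : A => val u) (g i)) =
      (fun i => pair_env (pair_env z1 z0) y (match g i with
        inl t => inr t | inr _ => inl (inl i) end)) by [].
    apply: funext => i; case Eg: (g i) => [t|u] //=; by rewrite /z1 Eg.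
  move=> x Hx; split=> [l l'|].
    by have [Hl _] := Hx l l'; rewrite !E.
  by apply: csP => l l'; have [_ /(agree_fmap cs inr)] := Hx l l'.
pose K := ({P : ('I_r * 'I_m -> U) -> Prop | definable M P /\ P (fun p => c p.1 p.2)} *
  seq {P : ('I_m -> U) -> Prop | definable A P})%type.
have kT : {P : ('I_r * 'I_m -> U) -> Prop | definable M P /\ P (fun p => c p.1 p.2)}.
  by exists (fun _ => True); split=> //; exact: definable_prop.
have [|[[P [dP Pc]] s] [[Q [dQ Qc]] s']|G [uG GB]] := @ultra_of_base _ K
    (fun k x => [/\ valued M x, sval k.1 x & sames k.2 x]) (kT, [::]).
- move=> [[P [dP Pc]] s] /=; have [W [z0 [cs csP]]] := pack s.
  have [x [Mx Px Hx]] := mono_in_model nip modU satU eM cM cb dP Pc cs z0.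
  by exists x; split=> //; exact: csP.
- have dPQ : definable M (fun e => P e /\ Q e) /\
      (P (fun p => c p.1 p.2) /\ Q (fun p => c p.1 p.2)).
    by split=> //; exact: definable_and.
  exists (exist (fun P => definable M P /\ P (fun p => c p.1 p.2)) _ dPQ, s ++ s').
  move=> x /= [Mx [Px Qx] Hs].
  have [Hs1 Hs2] : sames s x /\ sames s' x.
    by elim: s Hs => [|p s IH] //= [Hp /IH [H1 H2]].
  by split; split.
have [y yP] := satU cA uG.
exists y; split.
- move=> P dP; rewrite (yP _ (definable_mono MA dP)).
  rewrite (ultra_equiv (a := fun p => c p.1 p.2) uG _ dP) // => Q dQ Qc.
  have dQc : definable M Q /\ Q (fun p => c p.1 p.2) by [].
  apply: (ultra_sub uG (GB (exist (fun P => definable M P /\ P (fun p => c p.1 p.2)) _ dQc,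
    [::]))).
  by move=> x [].
- move=> P dP l l'; set Q := fun x : 'I_r * 'I_m -> U =>
    P (fun t => x (l, t)) <-> P (fun t => x (l', t)).
  suff : Q y by [].
  apply/yP.
    by apply: definable_iff; apply: (definable_pull _ dP) => t; left;
      [exists (l, t)|exists (l', t)].
  apply: (ultra_sub uG (GB (kT, [:: exist _ _ dP]))) => x [_ _ [H _]]; exact: H.
- move=> Q dQ /yP GQ.
  have GM : G (valued M) by apply: (ultra_sub uG (GB (kT, [::]))) => x [].
  exact: (ultra_ex uG (ultra_and uG GM (GQ dQ))).
Qed.

(** Each row is a strict tuple over [M] and the earlier rows. The entry [u0] fills the rows from [N]
    on, so that selections of any length share one type of variables. *)
Lemma strict_array (u0 : U) : M u0 ->
  exists Y : nat -> 'I_r * 'I_m -> U,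
    (forall i, equiv_over M (Y i) (fun p => c p.1 p.2)) /\
    forall N (sel sel' : nat -> 'I_r),
      equiv_over M (fun p : nat * 'I_m => if (p.1 < N)%N then Y p.1 (sel p.1, p.2) else u0)
                   (fun p : nat * 'I_m => if (p.1 < N)%N then Y p.1 (sel' p.1, p.2) else u0).
Proof.
move=> Mu0.
pose w (s : seq ('I_r * 'I_m -> U)) (sel : nat -> 'I_r) (p : nat * 'I_m) :=
  nth (fun _ => u0) s p.1 (sel p.1, p.2).
pose inv s := forall sel sel', equiv_over M (w s sel) (w s sel').
have step s : exists y, equiv_over M y (fun p => c p.1 p.2) /\ (inv s -> inv (rcons s y)).
  pose A := M `|` range (fun p : nat * ('I_r * 'I_m) => nth (fun _ => u0) s p.1 p.2).
  have MA : M `<=` A by move=> u; left.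
  have cA : countable A by apply: countable_setU => //; exact: countable_range.
  have wA sel p : A (w s sel p) by right; exists (p.1, (sel p.1, p.2)).
  have [y [yc ysame yfs]] := strict_tuple MA cA.
  exists y; split=> // invs.
  have one sel sel' P : definable M P -> P (w (rcons s y) sel) -> P (w (rcons s y) sel').
    move=> dP; apply: contraPP => nP'.
    have wup t : w (rcons s y) t = set_slot (size s) (w s t) (fun i => y (t (size s), i)).
      apply: funext => -[j i]; rewrite /w /set_slot nth_rcons /=.
      case: ltngtP => [//|gt|-> //]; first by rewrite nth_default // ltnW.
    move: nP'; rewrite !wup => nP' Py.
    have dv e : valued A e -> definable A (fun v => P (set_slot (size s) e v)).
      by move=> Ae; apply: definable_set_slotr => //; exact: definable_mono dP.
    (* No set over [M] and the earlier rows distinguishes the columns of the new row, so [sel'] may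
       be assumed to use the same last column as [sel]. *)
    move/(ysame _ (dv _ (wA sel')) _ (sel (size s))): nP' => nP'.
    set l := sel (size s) in nP' Py.
    (* The two selections now differ only in earlier rows. The new row can be replaced by a tuple x
       in [M] witnessing the same difference, and this contradicts [invs]. *)
    have dQ : definable A (fun x : 'I_r * 'I_m -> U =>
        P (set_slot (size s) (w s sel) (fun i => x (l, i))) /\
        ~ P (set_slot (size s) (w s sel') (fun i => x (l, i)))).
      by apply: definable_and; [|apply: definable_not]; apply: (definable_pull _ (dv _ (wA _)))
        => i; left; exists (l, i).
    have [x [Mx [Px nPx]]] := yfs _ dQ (conj Py nP').
    have dx : definable M (fun e => P (set_slot (size s) e (fun i => x (l, i)))).
      by apply: definable_set_slotl.
    by apply: nPx; apply/(invs sel sel' _ dx).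
  by move=> sel sel' P dP; split; exact: one.
have [Y YP] := dependent_choice_seq step.
exists Y; split=> [i|N]; first by have [] := YP i.
have E sel : (fun p : nat * 'I_m => if (p.1 < N)%N then Y p.1 (sel p.1, p.2) else u0) =
    w (mkseq Y N) sel.
  apply: funext => -[j t]; rewrite /w /=; case: ltnP => jN; first by rewrite nth_mkseq.
  by rewrite nth_default // size_mkseq.
move=> sel sel'; rewrite !E; move: sel sel'; rewrite -/(inv (mkseq Y N)).
elim: N {E} => [|N IH]; last by rewrite mkseqS; have [_] := YP N; apply.
move=> sel sel' P dP; suff -> : w (mkseq Y 0) sel = w (mkseq Y 0) sel' by [].
by apply: funext => p; rewrite /w !nth_nil.
Qed.

End Strict.

(** * Consistency of all conjugates *)

Lemma tp_eq (L : language) (U : structure L) (A : set U) (V : Type) (a a' : V -> U) :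
  equiv_over A a a' -> tp A a = tp A a'.
Proof.
move=> E; apply/seteqP; split=> psi [opsi psia]; split=> //;
  by apply/(E _ (psat_definable opsi)).
Qed.

Lemma psat_inst_right (L : language) (U : structure L) (X Y : Type)
    (phi : form L (X + Y)) (b : Y -> U) (a : X -> U) :
  psat (inst_right phi b) a = sat phi (pair_env a b).
Proof. by rewrite /psat sat_fmap; congr sat; apply: funext => -[]. Qed.

Lemma psat_inst_left (L : language) (U : structure L) (X Y : Type)
    (phi : form L (X + Y)) (b : Y -> U) (a : X -> U) :
  psat (inst_left phi a) b = sat phi (pair_env a b).
Proof. by rewrite /psat sat_fmap; congr sat; apply: funext => -[]. Qed.

Section Good.
Variables (L : language) (T : theory L) (U : structure L) (M : set U).
Hypotheses (nip : NIP T) (modU : models U T) (satU : countably_saturated U).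
Hypotheses (eM : elementary_substructure M) (cM : countable M).
Variables (n m : nat) (phi : form L ('I_n + 'I_m)) (b : 'I_m -> U).

Let R (x : 'I_n -> U) (y : 'I_m -> U) : Prop := sat phi (pair_env x y).

Definition good_upto (k : nat) (S : ('I_n -> U) -> Prop) : Prop :=
  forall y : nat -> 'I_m -> U, (forall i, equiv_over M (y i) b) ->
    exists x, S x /\ forall i, (i < k)%N -> R x (y i).

Definition good (S : ('I_n -> U) -> Prop) : Prop := forall k, good_upto k S.

(** Each row is conjugate to [c], so [x0] fails on some column of it. Given [E], select column [l0]
    in the rows where [E] holds and a failing column in the others. All selections have the same
    type over [M], so some point of [S] shows these signs along column [l0]. Injectivity of [idx]
    keeps the demands on a row from conflicting. *)
Lemma array_shattered (r : nat) (c : 'I_r -> 'I_m -> U) (u0 : U)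
    (Y : nat -> 'I_r * 'I_m -> U) (S : ('I_n -> U) -> Prop) (l0 : 'I_r)
    (k : nat) (idx : nat -> nat) (x0 : 'I_n -> U) :
  definable M S ->
  ~ (exists x, S x /\ forall l, R x (c l)) ->
  (forall i, equiv_over M (Y i) (fun p => c p.1 p.2)) ->
  (forall N (sel sel' : nat -> 'I_r),
    equiv_over M (fun p : nat * 'I_m => if (p.1 < N)%N then Y p.1 (sel p.1, p.2) else u0)
                 (fun p : nat * 'I_m => if (p.1 < N)%N then Y p.1 (sel' p.1, p.2) else u0)) ->
  {in gtn k &, injective idx} ->
  S x0 -> (forall j, (j < k)%N -> R x0 (fun t => Y (idx j) (l0, t))) ->
  shattered R k (fun j t => Y (idx j) (l0, t)).
Proof.
move=> dS nc Yc Ysel inj Sx0 Rx0 E.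
have /choice [lf lfP] i : exists l, ~ R x0 (fun t => Y i (l, t)).
  apply/existsNP => H.
  have dP : definable M (fun y : 'I_r * 'I_m -> U =>
      exists x, S x /\ forall l, R x (fun t => y (l, t))).
    apply: (@definable_ex _ _ _ _ _ (fun (y : 'I_r * 'I_m -> U) x =>
      S x /\ forall l, R x (fun t => y (l, t)))); lazy beta.
    apply: definable_and; first by apply: (definable_pull _ dS) => v; left; exists (inr v).
    apply: definable_forall => l; apply: definable_sat_pull => -[v|t]; left.
      by exists (inr v).
    by exists (inl (l, t)).
  by apply/nc/(Yc i _ dP); exists x0.
pose N := (\max_(j < k) idx j).+1.
have idxN j : (j < k)%N -> (idx j < N)%N.
  by move=> jk; rewrite ltnS; exact: (leq_bigmax (F := fun j : 'I_k => idx j) (Ordinal jk)).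
pose sel i := if `[< exists j, [/\ (j < k)%N, idx j = i & E j] >] then l0 else lf i.
pose P (e : nat * 'I_m -> U) := exists x, S x /\
  forall j : 'I_k, R x (fun t => e (idx j, t)) <-> E j.
have dP : definable M P.
  apply: (@definable_ex _ _ _ _ _ (fun (e : nat * 'I_m -> U) x => S x /\
    forall j : 'I_k, R x (fun t => e (idx j, t)) <-> E j)); lazy beta.
  apply: definable_and; first by apply: (definable_pull _ dS) => v; left; exists (inr v).
  apply: definable_forall => j; apply: definable_iff; last exact: definable_prop.
  apply: definable_sat_pull => -[v|t]; left; first by exists (inr v).
  by exists (inl (idx j : nat, t)).
have /(Ysel N sel (fun _ => l0) _ dP) [x [Sx Hx]] :
    P (fun p : nat * 'I_m => if (p.1 < N)%N then Y p.1 (sel p.1, p.2) else u0).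
  exists x0; split=> // j /=; rewrite idxN // /sel.
  case: asboolP => [[j' [j'k /inj e Ej]]|nE].
    rewrite -(e j'k (ltn_ord j)); split=> // _; exact: Rx0.
  by split=> [/lfP//|Ej]; case: nE; exists j; split.
exists x => j jk; have := Hx (Ordinal jk); by rewrite /= idxN.
Qed.

(** If some realizations [y] were jointly inconsistent with [S], take a strict array of conjugates
    of them: [k0] entries of its first column are consistent with [S], hence shattered by
    [array_shattered]. *)
Lemma good_upto_vc (k0 : nat) (S : ('I_n -> U) -> Prop) :
  (forall y, ~ shattered R k0 y) -> definable M S -> good_upto k0 S -> good S.
Proof.
move=> vc dS good0 k y yb; apply: contrapT => nex.
case: k => [|k] in nex *.
  by have [x [Sx _]] := good0 y yb; apply: nex; exists x.
pose c (l : 'I_k.+1) := y l.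
have [u0 Mu0] := inhabited_elementary eM.
have [Y [Yc Ysel]] := strict_array nip modU satU eM cM (c := c) (fun l => yb l) Mu0.
have [|x0 [Sx0 Rx0]] := good0 (fun i t => Y i (ord0, t)).
  move=> i P dP; rewrite -(yb 0 P dP).
  by apply: (Yc i (fun x => P (fun t => x (ord0, t)))); apply: (definable_pull _ dP) => t;
    left; exists (ord0, t).
apply: (vc _ (array_shattered (c := c) (idx := id) dS _ Yc Ysel _ Sx0 Rx0)) => //.
by move=> [x [Sx Rx]]; apply: nex; exists x; split=> // i ik; exact: (Rx (Ordinal ik)).
Qed.

End Good.

(** * Indiscernible sequences from ultrafilters *)

(** Sequences of all lengths are coded by assignments on one variable type, with the constant [u0]
    from position [k] on. This allows induction on [k] without changing the variables of [P]. *)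
Definition seq_env (U : Type) (m : nat) (u0 : U) (k : nat) (e : nat -> 'I_m -> U)
    (p : nat * 'I_m) : U :=
  if (p.1 < k)%N then e p.1 p.2 else u0.

Lemma seq_envS (U : Type) (m : nat) (u0 : U) (k : nat) (e : nat -> 'I_m -> U) :
  seq_env u0 k.+1 e = set_slot k (seq_env u0 k e) (e k).
Proof.
apply: funext => -[j t]; rewrite /seq_env /set_slot /= ltnS.
by case: ltngtP => // ->.
Qed.

Lemma seq_env0 (U : Type) (m : nat) (u0 : U) (e e' : nat -> 'I_m -> U) :
  seq_env u0 0 e = seq_env u0 0 e'.
Proof. by []. Qed.

Section Morley.
Variables (L : language) (U : structure L) (A : set U) (m : nat).
Variables (D : (('I_m -> U) -> Prop) -> Prop) (u0 : U).
Hypotheses (satU : countably_saturated U) (cA : countable A) (Au0 : A u0).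
Hypotheses (uD : ultra D) (DA : D (valued A)).

Definition morley (e : nat -> 'I_m -> U) : Prop := forall k P,
  definable (A `|` range (fun p : 'I_k * 'I_m => e p.1 p.2)) P -> (P (e k) <-> D P).

Lemma morley_exists : exists e, morley e.
Proof.
have step (s : seq ('I_m -> U)) : exists v, forall P,
    definable (A `|` range (fun p : 'I_(size s) * 'I_m => nth (fun _ => u0) s p.1 p.2)) P ->
    (P v <-> D P).
  by apply: satU => //; apply: countable_setU => //; exact: countable_range.
have [e eP] := dependent_choice_seq step.
exists e => k P dP; apply: eP; apply: definable_mono dP => u [Au|[[i t] _ <-]]; first by left.
right; rewrite size_mkseq; exists (i, t) => //=; by rewrite nth_mkseq.
Qed.

Variable e : nat -> 'I_m -> U.
Hypothesis me : morley e.

Let stepD k i (P : (nat * 'I_m -> U) -> Prop) :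
  definable A P -> (forall j, (j < k)%N -> (i j < i k)%N) ->
  P (seq_env u0 k.+1 (fun j => e (i j))) <->
  D (fun v => P (set_slot k (seq_env u0 k (fun j => e (i j))) v)).
Proof.
move=> dP ik; rewrite seq_envS.
apply: (me (P := fun v => P (set_slot k (seq_env u0 k (fun j => e (i j))) v))).
apply: definable_set_slotr; last by apply: definable_mono dP => u; left.
move=> -[j t]; rewrite /seq_env /=; case: ifP => jk; last by left.
by right; exists (Ordinal (ik _ jk), t).
Qed.

Lemma morley_indiscernible k (i i' : nat -> nat) P :
  definable A P ->
  (forall j j', (j < j')%N -> (j' < k)%N -> (i j < i j')%N) ->
  (forall j j', (j < j')%N -> (j' < k)%N -> (i' j < i' j')%N) ->
  P (seq_env u0 k (fun j => e (i j))) <-> P (seq_env u0 k (fun j => e (i' j))).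
Proof.
elim: k P => [|k IH] P dP ii ii'; first by rewrite (seq_env0 _ _ (fun j => e (i' j))).
rewrite stepD // ?stepD // => [|j jk|j jk]; [|exact: ii'|exact: ii].
have H v : valued A v ->
    P (set_slot k (seq_env u0 k (fun j => e (i j))) v) <->
    P (set_slot k (seq_env u0 k (fun j => e (i' j))) v).
  move=> Av; apply: (IH (fun x => P (set_slot k x v))); first exact: definable_set_slotl.
    by move=> j j' jj' j'k; apply: ii => //; exact: ltnW.
  by move=> j j' jj' j'k; apply: ii' => //; exact: ltnW.
by split=> DP; apply: (ultra_sub uD (ultra_and uD DA DP)) => v [/H]; tauto.
Qed.

(** Terms of [e] are replaced from the last one backwards, since [e k] is generic over [A] and the
    earlier terms. Each replacement takes a larger index than those already used, so the indices are
    distinct. *)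
Lemma morley_descend (y : nat -> 'I_m -> U) k P :
  (forall N, D (fun v => exists i, (N <= i)%N /\ v = y i)) -> (forall i, valued A (y i)) ->
  definable A P -> P (seq_env u0 k e) ->
  forall N, exists idx : nat -> nat, [/\ forall j, (j < k)%N -> (N <= idx j)%N,
    {in gtn k &, injective idx} & P (seq_env u0 k (fun j => y (idx j)))].
Proof.
move=> Dy Ay; elim: k P => [|k IH] P dP Pe N.
  by exists id; split=> //; rewrite (seq_env0 _ _ e).
move: Pe; rewrite (stepD (i := id)) // => DP.
have [v [Pv [i [Ni vi]]]] := ultra_ex uD (ultra_and uD DP (Dy N)); rewrite vi in Pv.
have [|idx [idxN inj Pidx]] :=
  IH (fun x => P (set_slot k x (y i))) _ Pv i.+1; first exact: definable_set_slotl.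
exists (fun j => if j == k then i else idx j); split.
- move=> j; rewrite ltnS leq_eqVlt; case: eqP => //= _ /idxN.
  by move=> lt; apply: leq_trans Ni _; exact: ltnW.
- move=> j j'; rewrite !inE !ltnS (leq_eqVlt j k) (leq_eqVlt j' k).
  case: eqP => [->|_] /= jk; case: eqP => [->|_] //= j'k.
  + by move=> E; have := idxN _ j'k; rewrite -E ltnn.
  + by move=> E; have := idxN _ jk; rewrite E ltnn.
  + exact: inj.
rewrite seq_envS eqxx.
suff -> : seq_env u0 k (fun j => y (if j == k then i else idx j)) =
  seq_env u0 k (fun j => y (idx j)) by [].
by apply: funext => -[j t]; rewrite /seq_env /=; case: ifP => // jk; rewrite ltn_eqF.
Qed.

End Morley.

(** * Conjugating a sequence to a prescribed first term *)

Section Move.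
Variables (L : language) (U : structure L) (M : set U) (m : nat) (u0 : U).
Hypotheses (satU : countably_saturated U) (cM : countable M) (Mu0 : M u0).

(** Saturation supplies one term at a time: that a next term exists is a property over [M] of the
    earlier terms, so it passes from [e] to the copy. *)
Lemma move_sequence (e : nat -> 'I_m -> U) (b : 'I_m -> U) : equiv_over M (e 0) b ->
  exists e' : nat -> 'I_m -> U, e' 0 = b /\
    forall k, equiv_over M (seq_env u0 k e') (seq_env u0 k e).
Proof.
move=> e0b.
pose env (s : seq ('I_m -> U)) := seq_env u0 (size s) (nth (fun _ => u0) s).
pose inv s := equiv_over M (env s) (seq_env u0 (size s) e).
have envr s v : env (rcons s v) = set_slot (size s) (env s) v.
  rewrite /env size_rcons seq_envS nth_rcons ltnn eqxx; congr set_slot.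
  by apply: funext => -[j t]; rewrite /seq_env /=; case: ifP => // js; rewrite nth_rcons js.
have sufinv s : (forall P, definable M P -> P (seq_env u0 (size s) e) -> P (env s)) -> inv s.
  move=> H P dP; split; last exact: H.
  by move=> Ps; apply: contrapT => /(H _ (definable_not dP)).
have step s : exists v, (s = [::] -> v = b) /\ (inv s -> inv (rcons s v)).
  case: (posnP (size s)) => [/size0nil ->|s_gt0].
    exists b; split=> // _; apply: sufinv => P dP; rewrite size_rcons envr seq_envS.
    rewrite /env (seq_env0 _ (nth _ _) e) => Pe.
    have dP' := definable_set_slotr 0 (e := seq_env u0 0 e) (fun _ => Mu0) dP.
    by apply/(e0b _ dP').
  have [invs|ninv] := pselect (inv s); last first.
    by exists b; split=> [_|/ninv].
  pose k := size s.
  pose K := {P : (nat * 'I_m -> U) -> Prop | definable M P /\ P (seq_env u0 k.+1 e)}.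
  have kT : K by exists (fun _ => True); split=> //; exact: definable_prop.
  pose A := M `|` range (fun p : 'I_k * 'I_m => nth (fun _ => u0) s p.1 p.2).
  have cA : countable A by apply: countable_setU => //; exact: countable_range.
  have As : valued A (env s).
    move=> [j t]; rewrite /env /seq_env /=; case: ifP => jk; last by left.
    by right; exists (Ordinal jk, t).
  have [|||v vP] := @saturated_base _ U _ A K (fun P v => sval P (set_slot k (env s) v)) kT
    satU cA.
  - move=> [P [dP _]] /=; apply: definable_set_slotr => //.
    by apply: definable_mono dP => u; left.
  - move=> [P [dP Pe]] /=.
    have dQ : definable M (fun x => exists v, P (set_slot k x v)).
      apply: (@definable_ex _ _ _ _ _ (fun x v => P (set_slot k x v))); lazy beta.
      apply: (definable_pull _ dP) => p; rewrite /set_slot; left.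
      by case: (p.1 == k); [exists (inr p.2)|exists (inl p)].
    by apply/(invs _ dQ); exists (e k); rewrite -seq_envS.
  - move=> [P [dP Pe]] [Q [dQ Qe]].
    have dPQ : definable M (fun x => P x /\ Q x) /\
        (P (seq_env u0 k.+1 e) /\ Q (seq_env u0 k.+1 e)).
      by split=> //; exact: definable_and.
    by exists (exist (fun P => definable M P /\ P (seq_env u0 k.+1 e)) _ dPQ).
  exists v; split=> [E|_]; first by rewrite E in s_gt0.
  apply: sufinv => P dP; rewrite size_rcons envr => Pe.
  have dPe : definable M P /\ P (seq_env u0 k.+1 e) by [].
  exact: (vP (exist (fun P => definable M P /\ P (seq_env u0 k.+1 e)) _ dPe)).
have [e' eP] := dependent_choice_seq step.
exists e'; split; first by have [H _] := eP 0; exact: H.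
have invk k : inv (mkseq e' k).
  elim: k => [|k IH]; last by rewrite mkseqS; have [_] := eP k; apply.
  by apply: sufinv => P dP; rewrite /env (seq_env0 _ _ e).
move=> k; have := invk k; rewrite /inv /env size_mkseq.
suff -> : seq_env u0 k (nth (fun _ => u0) (mkseq e' k)) = seq_env u0 k e' by [].
by apply: funext => -[j t]; rewrite /seq_env /=; case: ifP => // jk; rewrite nth_mkseq.
Qed.

End Move.

(** * Extending good formulas *)

Section Main.
Variables (L : language) (T : theory L) (U : structure L) (M : set U).
Hypotheses (nip : NIP T) (modU : models U T) (satU : countably_saturated U).
Hypotheses (eM : elementary_substructure M) (cM : countable M).
Variables (n m : nat) (phi : form L ('I_n + 'I_m)) (b : 'I_m -> U).

Let R (x : 'I_n -> U) (y : 'I_m -> U) : Prop := sat phi (pair_env x y).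

Notation good := (good M phi b).

(** The first column of a strict array need not be indiscernible, so non-dividing is applied to a
    Morley sequence extracted from it and moved to start at [b]. Consistency of [k0] of its
    instances returns to [k0] distinct rows, and [array_shattered] contradicts the choice of
    [k0]. *)
Lemma nondividing_good : ~ divides M (set1 (inst_right phi b)) -> good (fun _ => True).
Proof.
move=> ndiv k y yb; apply: contrapT => nex.
have [k0 vc] := nip_vc nip modU satU phi.
have [u0 Mu0] := inhabited_elementary eM.
case: k => [|k] in nex *; first by apply: nex; exists (fun _ => u0).
pose c (l : 'I_k.+1) := y l.
have [Y [Yc Ysel]] := strict_array nip modU satU eM cM (c := c) (fun l => yb l) Mu0.
pose y0 i (t : 'I_m) := Y i (ord0, t).
have y0b i : equiv_over M (y0 i) b.
  move=> P dP; rewrite -(yb 0 P dP).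
  by apply: (Yc i (fun x => P (fun t => x (ord0, t)))); apply: (definable_pull _ dP) => t;
    left; exists (ord0, t).
(* [D] contains every tail of the column, so that finite patterns of its Morley sequence can be
   pulled back to distinct rows by [morley_descend]. *)
have [||D [uD DB]] := @ultra_of_base _ nat (fun N v => exists i, (N <= i)%N /\ v = y0 i) 0.
- by move=> N; exists (y0 N), N.
- move=> N N'; exists (maxn N N') => v [i [leNi ->]].
  by split; exists i; split=> //; apply: leq_trans leNi; rewrite ?leq_maxl ?leq_maxr.
pose A := M `|` range (fun p : nat * 'I_m => y0 p.1 p.2).
have cA : countable A by apply: countable_setU => //; exact: countable_range.
have MA : M `<=` A by move=> u; left.
have Ay i : valued A (y0 i) by move=> t; right; exists (i, t).
have DA : D (valued A) by apply: (ultra_sub uD (DB 0)) => v [i [_ ->]].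
have [e me] := morley_exists u0 satU cA uD.
have Au0 := MA _ Mu0.
have e0b : equiv_over M (e 0) b.
  move=> P dP; rewrite (me 0 P); last by apply: definable_mono dP => u Mu; left; exact: MA.
  split=> [/(ultra_and uD (DB 0)) /(ultra_ex uD) [v [[i [_ ->]]]]|Pb].
    by move/(y0b i P dP).
  by apply: (ultra_sub uD (DB 0)) => v [i [_ ->]]; apply/(y0b i P dP).
have [e' [e'0 ee']] := move_sequence satU cM Mu0 e0b.
have ind : indiscernible M e'.
  move=> l i j hi hj; apply: tp_eq => P dP.
  pose N := (maxn (\max_(u < l) i u) (\max_(u < l) j u)).+1.
  have tofirst (h : 'I_l -> nat) : (forall u, (h u < N)%N) ->
      P (fun u => e' (h u.1) u.2) <-> P (fun u => e (h u.1) u.2).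
    move=> hN.
    have dPh : definable M (fun x : nat * 'I_m -> U => P (fun u => x (h u.1, u.2))).
      by apply: (definable_pull _ dP) => u; left; exists (h u.1, u.2).
    have := ee' N _ dPh; rewrite /seq_env /=.
    have E (f : nat -> 'I_m -> U) : (fun u : 'I_l * 'I_m =>
      if (h u.1 < N)%N then f (h u.1) u.2 else u0) = (fun u => f (h u.1) u.2).
      by apply: funext => u; rewrite hN.
    by rewrite !E.
  (* Extended by 0 to all of [nat], as the sequences in [morley_indiscernible] are indexed; only
     arguments below [l] matter. *)
  pose ext (h : 'I_l -> nat) (a : nat) := if insub a is Some u then h u else 0.
  have env_ext (h : 'I_l -> nat) : (fun u : 'I_l * 'I_m => e (h u.1) u.2) =
      (fun u => seq_env u0 l (fun a => e (ext h a)) (val u.1, u.2)).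
    by apply: funext => u; rewrite /seq_env /ext /= ltn_ord valK.
  have homo_ext (h : 'I_l -> nat) : {homo h : u v / (u < v)%N} ->
      forall a a', (a < a')%N -> (a' < l)%N -> (ext h a < ext h a')%N.
    move=> hh a a' aa' a'l; rewrite /ext (insubT (gtn l) a'l).
    by rewrite (insubT (gtn l) (ltn_trans aa' a'l)) /=; exact: hh.
  rewrite !tofirst; last 2 first.
  - by move=> u; rewrite ltnS leq_max (leq_bigmax u) orbT.
  - by move=> u; rewrite ltnS leq_max (leq_bigmax u).
  rewrite !env_ext.
  apply: (morley_indiscernible Au0 uD DA me
    (P := fun x => P (fun u => x (val u.1, u.2)))); try exact: homo_ext.
  apply: definable_pull (definable_mono MA dP) => u; left; by exists (val u.1, u.2).
have cons : consistent [set inst_right phi (e' i) | i in [set: nat]].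
  apply: contrapT => ncons; apply: ndiv; exists m, e', phi; split=> //.
  by exists [set inst_right phi b]; split=> // x; rewrite e'0; apply.
have [||x [_ xP]] := cons [set inst_right phi (e' i) | i in `I_k0].
- exact/finite_image/finite_II.
- by move=> _ [i _ <-]; exists i.
pose P (v : nat * 'I_m -> U) := exists x, forall i : 'I_k0, R x (fun t => v (i : nat, t)).
have dP : definable M P.
  apply: (@definable_ex _ _ _ _ _ (fun (v : nat * 'I_m -> U) x =>
    forall i : 'I_k0, R x (fun t => v (i : nat, t)))); lazy beta.
  apply: definable_forall => i; apply: definable_sat_pull => -[v|t]; left.
    by exists (inr v).
  by exists (inl (i : nat, t)).
have /(ee' k0 P dP) Pe : P (seq_env u0 k0 e').
  exists x => i; rewrite /seq_env /= ltn_ord.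
  have := xP (inst_right phi (e' i)); rewrite psat_inst_right; apply.
  by exists (i : nat) => //=; exact: ltn_ord.
have [idx [_ inj [x0 Hx0]]] :=
  morley_descend Au0 uD me DB Ay (definable_mono MA dP) Pe 0.
have dT : definable M (fun _ : 'I_n -> U => True) by exact: definable_prop.
apply: (vc _ (array_shattered (c := c) (phi := phi) (l0 := ord0) (x0 := x0) dT _ Yc Ysel inj I _)).
  by move=> [x' [_ Rx]]; apply: nex; exists x'; split=> // i ik; exact: (Rx (Ordinal ik)).
by move=> j jk; have := Hx0 (Ordinal jk); rewrite /seq_env /= jk.
Qed.

Variable F : (('I_m -> U) -> Prop) -> Prop.
Hypotheses (uF : ultra F) (FM : F (valued M)).
Hypothesis Fb : forall P, definable M P -> P b -> F P.

(** Otherwise, by [good_upto_vc], F-most y have [k0] realizations of the type of [b] inconsistent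
    with [S] and phi(x;y). By saturation this transfers to y = [b], and [b] together with those
    realizations contradicts goodness of [S]. *)
Lemma good_add (S : ('I_n -> U) -> Prop) : definable M S -> good S ->
  F (fun y => good (fun x => S x /\ R x y)).
Proof.
move=> dS goodS.
have [k0 vc] := nip_vc nip modU satU phi.
suff : F (fun y => good_upto M phi b k0 (fun x => S x /\ R x y)).
  move=> H; apply: (ultra_sub uF (ultra_and uF FM H)) => y [My].
  apply: (good_upto_vc nip modU satU eM cM vc); apply: definable_and => //.
  by apply: definable_sat_pull => -[v|t]; [left; exists v|right; exists (y t)].
apply: contrapT => /(ultra_not uF) bad.
pose kill (y : 'I_m -> U) (ys : 'I_k0 * 'I_m -> U) :=
  ~ exists x, (S x /\ R x y) /\ forall i, R x (fun t => ys (i, t)).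
have dkill A (V : Type) (f : (V -> U) -> 'I_m -> U) (g : (V -> U) -> 'I_k0 * 'I_m -> U) :
    M `<=` A -> pullable A f -> pullable A g -> definable A (fun e => kill (f e) (g e)).
  move=> MA pf pg; apply: definable_not.
  apply: (@definable_ex _ _ _ _ _ (fun e x => (S x /\ R x (f e)) /\
    forall i, R x (fun t => g e (i, t)))); lazy beta.
  have pull (W : Type) (h : (V -> U) -> W -> U) : pullable A h ->
      pullable A (fun e : V + 'I_n -> U => h (fun v => e (inl v))).
    move=> ph w; case: (ph w) => [[v vP]|[u [Au uP]]]; last by right; exists u.
    by left; exists (inl v).
  apply: definable_and; [apply: definable_and|].
  - by apply: definable_pull (definable_mono MA dS) => v; left; exists (inr v).
  - by apply: definable_sat_pull => -[v|t]; [left; exists (inr v)|exact: (pull _ _ pf)].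
  - apply: definable_forall => i; apply: definable_sat_pull => -[v|t].
      by left; exists (inr v).
    exact: (pull _ _ pg (i, t)).
pose K := {P : ('I_m -> U) -> Prop | definable M P /\ P b}.
have kT : K by exists (fun _ => True); split=> //; exact: definable_prop.
pose A := M `|` range b.
have MA : M `<=` A by move=> u; left.
have cA : countable A by apply: countable_setU => //; exact: countable_range.
have dall B (P : ('I_m -> U) -> Prop) (V : Type) (g : (V -> U) -> 'I_k0 * 'I_m -> U) :
    pullable B g -> definable B P ->
    definable B (fun e => forall i, P (fun t => g e (i, t))).
  move=> pg dP; apply: definable_forall => i; apply: (definable_pull _ dP) => t; exact: pg.
have [|||ys ysP] := @saturated_base _ U _ A K
  (fun P ys => (forall i, sval P (fun t => ys (i, t))) /\ kill b ys) kT satU cA.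
- move=> [P [dP Pb]] /=; apply: definable_and.
    by apply: (dall A P _ (fun e => e)); [move=> p; left; exists p|exact: definable_mono dP].
  apply: (dkill A _ (fun _ => b) (fun e => e)) => // p; last by left; exists p.
  by right; exists (b p); split=> //; right; exists p.
- move=> [P [dP Pb]] /=.
  have dQ : definable M (fun y => exists ys : 'I_k0 * 'I_m -> U,
      (forall i, P (fun t => ys (i, t))) /\ kill y ys).
    apply: (@definable_ex _ _ _ _ _ (fun y (ys : 'I_k0 * 'I_m -> U) =>
      (forall i, P (fun t => ys (i, t))) /\ kill y ys)); lazy beta.
    apply: definable_and.
      by apply: (dall M P _ (fun e p => e (inr p))) => // p; left; exists (inr p).
    by apply: dkill => // p; left; [exists (inl p)|exists (inr p)].
  apply/(ultra_equiv uF Fb dQ); apply: (ultra_sub uF bad) => y /existsNP [ys].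
  move=> /not_implyP [ysb nex]; exists (fun p : 'I_k0 * 'I_m => ys p.1 p.2); split=> [i|].
    by apply/(ysb i P dP).
  move=> [x [Sx Rx]]; apply: nex; exists x; split=> // i ik; exact: (Rx (Ordinal ik)).
- move=> [P [dP Pb]] [Q [dQ Qb]].
  have dPQ : definable M (fun y => P y /\ Q y) /\ (P b /\ Q b).
    by split=> //; exact: definable_and.
  exists (exist (fun P => definable M P /\ P b) _ dPQ) => ys /= [H kb].
  by split; split=> // i; have [] := H i.
have [_ kb] := ysP kT; apply: kb.
(* Place 0 holds [b] and places 1 to [k0] the tuples [ys], so goodness of [S] is used for [k0.+1]
   realizations. *)
pose y i := if i is j.+1 then if insub j is Some j' then fun t => ys (j' : 'I_k0, t) else b else b.
have yb i : equiv_over M (y i) b.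
  case: i => [|j] P dP //=; case: insubP => //= j' _ _.
  split=> [Py|Pb].
    apply: contrapT => nPb.
    have dnP : definable M (fun y => ~ P y) /\ ~ P b by split=> //; exact: definable_not.
    by have [/(_ j')] := ysP (exist (fun P => definable M P /\ P b) _ dnP).
  have dPb : definable M P /\ P b by [].
  by have [/(_ j')] := ysP (exist (fun P => definable M P /\ P b) _ dPb).
have [x [Sx Rx]] := goodS k0.+1 y yb.
exists x; split=> [|i]; first by split=> //; exact: (Rx 0).
by have := Rx i.+1 (ltn_ord i); rewrite /= (valK i).
Qed.

(** If no good subset settled the sign, every good [S'] inside [S] would remain good with either
    sign of phi at F-most y. The same y can serve finitely many [S'], so a binary tree of depth [k0]
    yields a shattered sequence. *)
Lemma good_decide (S : ('I_n -> U) -> Prop) : definable M S -> good S ->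
  exists S', [/\ definable M S', good S', forall x, S' x -> S x &
    F (fun y => ~ good (fun x => S' x /\ ~ R x y))].
Proof.
move=> dS goodS; apply: contrapT => nex.
have [k0 vc] := nip_vc nip modU satU phi.
have both S' : definable M S' -> good S' -> (forall x, S' x -> S x) ->
    forall s : bool, F (fun y => good (fun x => S' x /\ (R x y <-> s))).
  move=> dS' gS' S'S [].
    apply: (ultra_sub uF (good_add dS' gS')) => y H k z zb.
    by have [x [[Sx Rx] Hx]] := H k z zb; exists x.
  have : ~ F (fun y => ~ good (fun x => S' x /\ ~ R x y)).
    by move=> H; apply: nex; exists S'; split.
  move=> nF; apply: (ultra_sub uF ((ultra_not uF _).2 nF)) => y /contrapT H k z zb.
  by have [x [[Sx Rx] Hx]] := H k z zb; exists x.
have tree k (J : finType) (S' : J -> ('I_n -> U) -> Prop) :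
    (forall j, [/\ definable M (S' j), good (S' j) & forall x, S' j x -> S x]) ->
    exists y : nat -> 'I_m -> U, forall j (E : nat -> Prop),
      exists x, S' j x /\ forall i, (i < k)%N -> (R x (y i) <-> E i).
  elim: k J S' => [|k IH] J S' HS'.
    exists (fun _ => b) => j E; have [_ gS' _] := HS' j.
    by have [//|x [Sx _]] := gS' 0 (fun _ => b); exists x.
  have : F (fun y => forall p : J * bool, good (fun x => S' p.1 x /\ (R x y <-> p.2))).
    by apply: ultra_forall => // -[j s] /=; have [? ? ?] := HS' j; exact: both.
  move=> /(ultra_and uF FM) /(ultra_ex uF) [y0 [My0 Hy0]].
  have [|y yP] := IH (J * bool)%type (fun p x => S' p.1 x /\ (R x y0 <-> p.2)).
    move=> p; have [dS' gS' S'S] := HS' p.1; split=> //; last by move=> x [/S'S].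
    apply: definable_and => //; apply: definable_iff; last exact: definable_prop.
    by apply: definable_sat_pull => -[v|t]; [left; exists v|right; exists (y0 t)].
  exists (fun i => if i is i'.+1 then y i' else y0) => j E.
  have [x [[Sx R0] Rx]] := yP (j, `[< E 0 >]) (fun i => E i.+1).
  exists x; split=> // -[|i] ik; last exact: Rx.
  by rewrite R0 /=; split=> [/asboolP|H]; last exact/asboolP.
have [|y yP] := tree k0 unit (fun _ => S); first by [].
by apply: (vc y) => E; have [x [_ Hx]] := yP tt E; exists x.
Qed.

End Main.

(** * Points all of whose [M]-definable properties are good *)

Section Forcing.
Variables (L : language) (U : structure L) (M : set U).
Hypotheses (satU : countably_saturated U) (cM : countable M).
Variables (n m : nat) (phi : form L ('I_n + 'I_m)) (b : 'I_m -> U).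

Notation good := (good M phi b).

(** The [k1] realizations refuting [P], followed by the [k2] refuting [Q], refute the union. So the
    sets that are not good form an ideal. *)
Lemma good_or (P Q : ('I_n -> U) -> Prop) :
  good (fun x => P x \/ Q x) -> good P \/ good Q.
Proof.
move=> goodPQ; apply: contrapT => /not_orP [/existsNP [k1 nP] /existsNP [k2 nQ]].
move/existsNP: nP => [y1 /not_implyP [y1b n1]].
move/existsNP: nQ => [y2 /not_implyP [y2b n2]].
have [|x [PQx Rx]] := goodPQ (k1 + k2) (fun i => if (i < k1)%N then y1 i else y2 (i - k1)%N).
  by move=> i; case: ifP.
case: PQx => [Px|Qx].
  apply: n1; exists x; split=> // i ik; have := Rx i; rewrite ik; apply.
  exact: leq_trans ik (leq_addr _ _).
apply: n2; exists x; split=> // i ik; have := Rx (k1 + i).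
by rewrite (ltnNge _ k1) leq_addr addKn ltn_add2l; apply.
Qed.

Lemma global_coheir_ultra (p : set (pform U 'I_m)) : global_coheir M (tp M b) p ->
  exists F, [/\ ultra F, F (valued M), (forall P, definable M P -> P b -> F P) &
    forall psi, p psi -> F (psat psi)].
Proof.
move=> [_ tpp fsp].
pose K := {s : set (pform U 'I_m) | finite_set s /\ s `<=` p}.
have k0 : K by exists set0; split.
have [|[s [fs sp]] [s' [fs' s'p]]|F [uF FB]] := @ultra_of_base _ K
  (fun s a => valued M a /\ forall psi, sval s psi -> psat psi a) k0.
- by move=> [s [fs sp]]; have [a Ha] := fsp s fs sp; exists a.
- have ss' : finite_set (s `|` s') /\ s `|` s' `<=` p.
    by split; [rewrite finite_setU|move=> psi [/sp|/s'p]].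
  exists (exist (fun s => finite_set s /\ s `<=` p) _ ss') => a /= [Ma Ha].
  by split; split=> // psi H; apply: Ha; [left|right].
have Fp psi : p psi -> F (psat psi).
  move=> ppsi; have ss : finite_set [set psi] /\ [set psi] `<=` p.
    by split=> // _ ->.
  apply: (ultra_sub uF (FB (exist (fun s => finite_set s /\ s `<=` p) _ ss))) => a [_].
  exact.
exists F; split=> //; first by apply: (ultra_sub uF (FB k0)) => a [].
move=> P dP Pb; have [psi [opsi psiP]] := definable_psat dP.
have ppsi : p psi by apply: tpp; split=> //; apply/psiP.
by apply: (ultra_sub uF (Fp _ ppsi)) => a /psiP.
Qed.

(** A good [S k] is not contained in any definable set that is not good, and by [good_or] such sets
    are closed under unions. Compactness then gives a point avoiding all of them. *)
Lemma good_realization (S : nat -> ('I_n -> U) -> Prop) :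
  (forall k, definable M (S k)) -> (forall k, good (S k)) ->
  (forall k x, S k.+1 x -> S k x) ->
  exists a, (forall k, S k a) /\ forall P, definable M P -> P a -> good P.
Proof.
move=> dS goodS Sdec.
have Sle k l x : (k <= l)%N -> S l x -> S k x.
  by move=> /subnK <-; elim: (l - k)%N => // i IH /Sdec.
pose K := (nat * {P : ('I_n -> U) -> Prop | definable M P /\ ~ good P})%type.
have nF : definable M (fun _ : 'I_n -> U => False) /\ ~ good (fun _ => False).
  split; first exact: definable_prop.
  by move=> H; have [//|x []] := H 0 (fun _ => b).
pose bad P := definable M P /\ ~ good P.
have [|||a aP] := @saturated_base _ U _ M K (fun k x => S k.1 x /\ ~ sval k.2 x)
  (0, exist bad _ nF) satU cM.
- move=> [k [P [dP _]]] /=; apply: definable_and => //; exact: definable_not.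
- move=> [k [P [dP nP]]] /=; apply: contrapT => nex; apply: nP => l y yb.
  have [x [Sx Rx]] := goodS k l y yb; exists x; split=> //.
  by apply: contrapT => nPx; apply: nex; exists x.
- move=> [k [P [dP nP]]] [l [Q [dQ nQ]]].
  have nPQ : definable M (fun x => P x \/ Q x) /\ ~ good (fun x => P x \/ Q x).
    by split; [exact: definable_or|move=> /good_or []].
  exists (maxn k l, exist bad _ nPQ) => x /= [Sx /not_orP [nPx nQx]].
  by split; split=> //; apply: Sle Sx; rewrite ?leq_maxl ?leq_maxr.
exists a; split=> [k|P dP Pa]; first by have [] := aP (k, exist bad _ nF).
apply: contrapT => nP; have bP : definable M P /\ ~ good P by [].
by have [] := aP (0, exist bad _ bP).
Qed.

End Forcing.

(** * Treating the countably many coheirs in turn *)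

Theorem theorem2p17 (L : language) (T : theory L) (kappa : Type)
    (U : structure L) (M : set U) (n m : nat)
    (phi : form L ('I_n + 'I_m)) (b : 'I_m -> U) :
  countable_language L ->
  complete_theory T ->
  NIP T ->
  monster_model T kappa U ->
  elementary_substructure M ->
  countable M ->
  ~ divides M (set1 (inst_right phi b)) ->
  countable (global_coheir M (tp M b)) ->
  exists a : 'I_n -> U,
    forall p, global_coheir M (tp M b) p -> p (inst_left phi a).
Proof.
move=> _ _ nip mon eM cM ndiv /countable_injP [f finj].
have satU := monster_saturated mon; have [modU _ _ _] := mon.
pose R (x : 'I_n -> U) (y : 'I_m -> U) := sat phi (pair_env x y).
pose forces (S : ('I_n -> U) -> Prop) p := exists F, [/\ ultra F, F (valued M),
  (forall psi, p psi -> F (psat psi)) &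
  F (fun y => ~ good M phi b (fun x => S x /\ ~ R x y))].
(* Stage [size s] shrinks the last set of [s], initially everything, to settle the coheir numbered
   [size s] by the injection [f]; if there is none, the set is kept. *)
have step (s : seq (('I_n -> U) -> Prop)) : exists S : ('I_n -> U) -> Prop,
    definable M (last (fun _ => True) s) /\ good M phi b (last (fun _ => True) s) ->
    [/\ definable M S, good M phi b S, forall x, S x -> last (fun _ => True) s x &
      forall p, global_coheir M (tp M b) p -> f p = size s -> forces S p].
  set S0 := last _ _.
  have [[dS0 gS0]|] := pselect (definable M S0 /\ good M phi b S0); last by exists S0.
  have [[p [Xp fp]]|np] :=
    pselect (exists p, global_coheir M (tp M b) p /\ f p = size s); last first.
    by exists S0 => _; split=> // p Xp fp; case: np; exists p.
  have [F [uF FM Fb Fp]] := global_coheir_ultra Xp.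
  have [S [dS gS SS0 FS]] := good_decide nip modU satU eM cM uF FM Fb dS0 gS0.
  exists S => _; split=> // p' Xp' fp'.
  have -> : p' = p by apply: finj; rewrite ?inE // fp fp'.
  by exists F.
have [S SP] := dependent_choice_seq step.
have SPk k : definable M (last (fun _ => True) (mkseq S k)) /\
    good M phi b (last (fun _ => True) (mkseq S k)).
  elim: k => [|k IH]; last by have [dS gS _ _] := SP k IH; rewrite mkseqS last_rcons.
  split; first exact: definable_prop.
  exact: nondividing_good ndiv.
have [|||a [Sa ga]] := @good_realization _ _ M satU cM _ _ phi b S.
- by move=> k; have [] := SP k (SPk k).
- by move=> k; have [] := SP k (SPk k).
- by move=> k x; have [_ _ + _] := SP k.+1 (SPk k.+1); rewrite mkseqS last_rcons; apply.
exists a => p Xp; have [[_ _ compl] _ _] := Xp.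
(* If [p] contained the negation, some y in [M] would satisfy it while the stage of [p] made
   [S (f p)] with the negation of phi(x;y) not good. But [a] lies in that [M]-definable set, which
   is therefore good. *)
case: (compl _ (over_setT (inst_left phi a))) => // pN.
have [dS _ _ /(_ p Xp)] := SP (f p) (SPk (f p)); rewrite size_mkseq.
move=> /(_ erefl) [F [uF FM Fp FS]].
have := ultra_and uF (ultra_and uF FM FS) (Fp _ pN).
move=> /(ultra_ex uF) [y [[My nG]]]; rewrite /psat /= => nphi.
exfalso; apply: nG; apply: ga.
  apply: definable_and => //; apply: definable_not.
  by apply: definable_sat_pull => -[v|t]; [left; exists v|right; exists (y t)].
split=> // Ray; apply: nphi.
by have := psat_inst_left phi y a; rewrite /psat => ->.
Qed.
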